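(* Let $\tfrac12\le\theta<1$, let $P=p(x,D)=\sum_{|\alpha|+|\beta|\le m}c_{\alpha\beta}x^\beta D^\alpha$ be a differential operator on $\mathbb{R}^d$ with polynomial coefficients ($c_{\alpha\beta}\in\mathbb{C}$), and let $u\in\mathcal{S}_\theta'(\mathbb{R}^d)$. Then $$\mathrm{WF}^\theta_{\mathrm{gl}}(u)\subset \mathrm{WF}^\theta_{\mathrm{gl}}(Pu)\cup \mathrm{Char}(P).$$
   Context: $\mathcal{S}_\theta(\mathbb{R}^d)$ is the union over $C>0$ of the Banach spaces of all $f\in C^\infty(\mathbb{R}^d)$ with $\sup_{\alpha,\beta\in\mathbb{N}^d}\sup_{x} C^{-|\alpha|-|\beta|}(\alpha!\,\beta!)^{-\theta}|x^\alpha\partial^\beta f(x)|<\infty$, with the inductive limit topology. $\mathcal{S}_\theta'(\mathbb{R}^d)$ is its topological dual; $\langle\cdot,\cdot\rangle$ is the bilinear duality pairing. $T^*\mathbb{R}^d$ is identified with $\mathbb{R}^{2d}$; a subset of $\mathbb{R}^{2d}\setminus\{0\}$ is conic if it is invariant under multiplication of all $2d$ coordinates by positive reals. Global wave front set: for $u\in\mathcal{S}_\theta'(\mathbb{R}^d)$, a point $(x_0,\xi_0)\in\mathbb{R}^{2d}\setminus\{0\}$ is not in $\mathrm{WF}^\theta_{\mathrm{gl}}(u)$ iff there are an open conic neighbourhood $\Gamma'$ of $(x_0,\xi_0)$ and $C,\varepsilon>0$ with $$\left|\left\langle u_y, e^{-i\langle y,\xi\rangle-\frac12|y-x|^2}\right\rangle\right|\le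 C e^{-\varepsilon(|x|^{1/\theta}+|\xi|^{1/\theta})},\qquad (x,\xi)\in\Gamma'.$$ $D^\alpha=(-i)^{|\alpha|}\partial^\alpha$. The principal symbol of $P$ is $p_m(x,\xi)=\sum_{|\alpha|+|\beta|=m}c_{\alpha\beta}x^\beta\xi^\alpha$ and $\mathrm{Char}(P)=\{(x,\xi)\in T^*\mathbb{R}^d: p_m(x,\xi)=0\}$. *)

(* Defs.v *)
From mathcomp Require Import all_boot all_order all_algebra.
From mathcomp Require Import all_classical all_reals all_analysis.
From mathcomp Require Import complex.

Set Implicit Arguments.
Unset Strict Implicit.
Unset Printing Implicit Defensive.

Import Order.TTheory GRing.Theory Num.Theory.
Import numFieldNormedType.Exports.
Import ComplexField.Normc.

Local Open Scope classical_set_scope.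
Local Open Scope ring_scope.
Local Open Scope complex_scope.

Section GelfandShilov.
Context {R : realType} {d : nat}.

Local Notation E := 'rV[R]_d.
Local Notation C := R[i].
Local Notation multiindex := ('I_d -> nat).

Implicit Types (a b : multiindex) (x y xi : E) (f g : E -> C).

Definition mdeg a : nat := (\sum_(i < d) a i)%N.
Definition mfact a : nat := (\prod_(i < d) (a i)`!)%N.
Definition monomial a x : R := \prod_(i < d) x 0 i ^+ a i.

Definition dot x y : R := \sum_(i < d) x 0 i * y 0 i.

(* The Euclidean norm: the norm `|x| that the library puts on row vectors is
   the maximum norm. *)
Definition enorm x : R := Num.sqrt (dot x x).

(* R[i] carries no normed R-module structure, so partial derivatives of
   complex-valued functions are taken on real and imaginary parts. *)
Definition partial (i : 'I_d) f : E -> C := fun x =>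
  'D_(delta_mx 0 i) (fun y => complex.Re (f y)) x +i*
  'D_(delta_mx 0 i) (fun y => complex.Im (f y)) x.

Definition mpartial a f : E -> C :=
  foldr (fun i g => iter (a i) (partial i) g) f (enum 'I_d).

(* C^oo: the partial derivatives of all orders, in any order of the variables,
   exist and are continuous. *)
Definition smooth f : Prop :=
  forall s : seq 'I_d, let g := foldr partial f s in
  [/\ continuous (fun x => complex.Re (g x)), continuous (fun x => complex.Im (g x)) &
      forall (i : 'I_d) x,
        derivable (fun y => complex.Re (g y)) x (delta_mx 0 i) /\
        derivable (fun y => complex.Im (g y)) x (delta_mx 0 i)].

(* - i is spelled out, since the library leaves unspecified which square root
   of -1 the 'i of the closed field R[i] is. *)
Definition Dop a f : E -> C := fun x => (0 -i* 1) ^+ mdeg a * mpartial a f x.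

Definition GS_norm (theta A : R) f : \bar R :=
  ereal_sup [set r | exists a b x,
    r = (A ^- (mdeg a + mdeg b) *
         (mfact a * mfact b)%:R `^ (- theta) *
         normc ((monomial a x)%:C * mpartial b f x))%:E].

Definition GS_step (theta A : R) : set (E -> C) :=
  [set f | smooth f /\ (GS_norm theta A f < +oo)%E].

Definition GS (theta : R) : set (E -> C) :=
  \bigcup_(A in [set A : R | 0 < A]) GS_step theta A.

Definition absolutely_convex (V : set (E -> C)) : Prop :=
  forall f g (s t : C), V f -> V g -> normc s + normc t <= 1 ->
    V (fun x => s * f x + t * g x).

(* The basis of neighbourhoods of 0 of the locally convex inductive limit
   topology: absolutely convex sets that meet every step in a neighbourhood
   of 0 of that Banach space. *)
Definition GS_nbhs0 (theta : R) (V : set (E -> C)) : Prop :=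
  [/\ V `<=` GS theta, absolutely_convex V &
      forall A : R, 0 < A -> exists2 delta : R, 0 < delta &
        forall f, GS_step theta A f -> (GS_norm theta A f < delta%:E)%E -> V f].

Definition GS_open (theta : R) (U : set (E -> C)) : Prop :=
  U `<=` GS theta /\
  forall f, U f -> exists2 V, GS_nbhs0 theta V &
    forall g, V g -> U (fun x => f x + g x).

(* Functionals are total functions on E -> C, of which only the values on
   GS theta matter. *)
Definition GS_dual (theta : R) (u : (E -> C) -> C) : Prop :=
  (forall f g (s t : C), GS theta f -> GS theta g ->
     u (fun x => s * f x + t * g x) = s * u f + t * u g) /\
  (forall O : set C^o, open O -> GS_open theta (GS theta `&` u @^-1` O)).

Definition dual_monomial b (u : (E -> C) -> C) : (E -> C) -> C :=
  fun f => u (fun x => (monomial b x)%:C * f x).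

Definition dual_Dop a (u : (E -> C) -> C) : (E -> C) -> C :=
  fun f => (- 1) ^+ mdeg a * u (Dop a f).

(* The test function y |-> exp (- i <y, xi> - |y - x|^2 / 2). *)
Definition wave_packet x xi : E -> C := fun y =>
  (expR (- (enorm (y - x) ^+ 2 / 2)))%:C *
  (cos (dot y xi) -i* sin (dot y xi)).

Definition conic (G : set (E * E)) : Prop :=
  ~ G (0, 0) /\
  forall (t : R) (p : E * E), 0 < t -> G p -> G (t *: p.1, t *: p.2).

Definition WFgl (theta : R) (u : (E -> C) -> C) : set (E * E) :=
  [set p | p <> (0, 0) /\
    ~ exists2 G : set (E * E), [/\ open G, conic G & G p] &
      exists A eps : R, [/\ 0 < A, 0 < eps & forall x xi, G (x, xi) ->
        normc (u (wave_packet x xi)) <=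
        A * expR (- (eps * (enorm x `^ theta^-1 + enorm xi `^ theta^-1)))]].

Section operator.
Variables (m : nat) (c : multiindex -> multiindex -> C).

(* Multi-indices of length at most m have components at most m; they are
   enumerated as functions into 'I_m.+1. *)
Local Notation bmi := {ffun 'I_d -> 'I_m.+1}.

Definition mi (a : bmi) : multiindex := fun i => a i.

Definition diffop (u : (E -> C) -> C) : (E -> C) -> C := fun f =>
  \sum_(ab : bmi * bmi | (mdeg (mi ab.1) + mdeg (mi ab.2) <= m)%N)
    c (mi ab.1) (mi ab.2) * dual_monomial (mi ab.2) (dual_Dop (mi ab.1) u) f.

Definition psymbol x xi : C :=
  \sum_(ab : bmi * bmi | (mdeg (mi ab.1) + mdeg (mi ab.2) == m)%N)
    c (mi ab.1) (mi ab.2) *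
    (monomial (mi ab.2) x)%:C * (monomial (mi ab.1) xi)%:C.

Definition Char : set (E * E) := [set p | psymbol p.1 p.2 = 0].

End operator.
End GelfandShilov.

(* Main.v *)
Require Import Defs.
From mathcomp Require Import all_boot all_order all_algebra.
From mathcomp Require Import all_classical all_reals all_analysis.
From mathcomp Require Import complex ring lra.

(** The transform F(x, xi) = <u, wave packet at (x, xi)> of u extends
    holomorphically: for t in C^d and s = y - x, the functional
    L(t) = <u, e^(t.s) wave_packet(x, xi)> is, up to a factor of modulus
    e^(|Re t|^2/2), the value of F at (x + Re t, xi - Im t). The derivatives of L
    at 0 are <u, s^k wave_packet>, so Cauchy's estimates bound these by
    k! r^(-|k|) times the supremum of |F| over a box of radius r. The transposed
    operator sends the wave packet to the principal symbol times the wave packet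
    plus terms s^k wave_packet whose coefficients have lower order, and with
    r = K/|z|, K large, these are at most a small multiple of |z|^m sup |F|. Hence,
    where the principal symbol is elliptic,
      |F(z)| <= C |F_Pu(z)| + (1/2) sup {|F(w)| : |w - z| <= K/|z|}.
    Inside a cone this can be iterated about |z|^2 times, which gains a factor
    e^(-c|z|^2) over the a priori bound |F(z)| <= C_delta e^(delta |z|^(1/theta));
    since 1/theta <= 2 this is the required decay. *)

Set Implicit Arguments.
Unset Strict Implicit.
Unset Printing Implicit Defensive.
Import Order.TTheory GRing.Theory Num.Theory.
Import numFieldNormedType.Exports.
Import ComplexField.Normc.
Local Open Scope classical_set_scope.
Local Open Scope ring_scope.
Local Open Scope complex_scope.

Arguments normc : simpl never.

(** * Complex modulus, exponential and derivatives *)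

Section ComplexModulus.
Context {R : realType}.
Implicit Types z w : R[i].

(** No theory of holomorphic functions enters: L is reached only through its Taylor polynomials at
    0, whose remainders tend to 0 in one fixed step of the test space, and the Cauchy estimate is a
    finite average over roots of unity. Every test function in use is a tensor product of
    one-variable functions, polynomial times Gaussian times exponential, so derivatives are index
    shifts and Cauchy's estimate is applied one variable at a time. The radius K/|z| balances two
    costs. Per factor of size |z| in the symbol, differentiating the polynomial in y - x costs r and
    multiplying it by y - x costs a multiple of 1/r; both are small against |z| once K, and then
    |z|, is large. The a priori bound holds for every delta because u is continuous on every step: a
    larger step parameter slows the growth in |z| of the seminorm of a wave packet, at the price of
    another constant. Besides the final comparison of exponents, theta >= 1/2 is what places the
    wave packets in the test space, since Gaussian moments grow like sqrt(n!) <= n!^theta. *)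

Lemma normr_normc z : `|z| = (normc z)%:C.
Proof. by case: z. Qed.

Lemma normc_ge0 z : 0 <= normc z.
Proof. by case: z => a b; exact: sqrtr_ge0. Qed.

Lemma normcD z w : normc (z + w) <= normc z + normc w.
Proof. by have := ler_normD z w; rewrite !normr_normc -rmorphD lecR. Qed.

Lemma normcN z : normc (- z) = normc z.
Proof. by have := normrN z; rewrite !normr_normc => /complexI. Qed.

Lemma normcX z n : normc (z ^+ n) = normc z ^+ n.
Proof. by have := normrX n z; rewrite !normr_normc -rmorphXn => /complexI. Qed.

Lemma normc_real (a : R) : normc a%:C = `|a|.
Proof. by rewrite /normc /= expr0n addr0 sqrtr_sqr. Qed.

Lemma normc_nat n : normc (n%:R : R[i]) = n%:R.
Proof. by have := normr_nat R[i] n; rewrite normr_normc -(rmorph_nat (real_complex R)) => /complexI. Qed.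

Lemma normc_prod (I : Type) (s : seq I) (P : pred I) (F : I -> R[i]) :
  normc (\prod_(i <- s | P i) F i) = \prod_(i <- s | P i) normc (F i).
Proof.
apply: (big_ind2 (fun z x => normc z = x)) => [|z x w y <- <-|//].
  exact: normc1.
exact: normcM.
Qed.

Lemma normc_sum (I : Type) (s : seq I) (P : pred I) (F : I -> R[i]) :
  normc (\sum_(i <- s | P i) F i) <= \sum_(i <- s | P i) normc (F i).
Proof.
apply: (big_ind2 (fun z x => normc z <= x)) => //; first by rewrite normc0.
by move=> z x w y zx wy; apply: le_trans (normcD _ _) (lerD zx wy).
Qed.

Lemma ler_Re_normc z : `|complex.Re z| <= normc z.
Proof. by case: z => a b; rewrite /normc /= -sqrtr_sqr ler_wsqrtr// lerDl sqr_ge0. Qed.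

Lemma ler_Im_normc z : `|complex.Im z| <= normc z.
Proof. by case: z => a b; rewrite /normc /= -sqrtr_sqr ler_wsqrtr// lerDr sqr_ge0. Qed.

Lemma normc_le_ReIm z : normc z <= `|complex.Re z| + `|complex.Im z|.
Proof.
rewrite {1}(complexE z); apply: le_trans (normcD _ _) _.
rewrite normcM !normc_real (_ : normc ('i : R[i]) = 1) ?mul1r//.
by rewrite /normc expr0n add0r expr1n sqrtr1.
Qed.

Lemma Re_addc z w : complex.Re (z + w) = complex.Re z + complex.Re w.
Proof. by case: z w => [? ?] []. Qed.
Lemma Im_addc z w : complex.Im (z + w) = complex.Im z + complex.Im w.
Proof. by case: z w => [? ?] []. Qed.
Lemma Re_oppc z : complex.Re (- z) = - complex.Re z.
Proof. by case: z. Qed.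
Lemma Im_oppc z : complex.Im (- z) = - complex.Im z.
Proof. by case: z. Qed.
Lemma Re_mulc z w : complex.Re (z * w) = complex.Re z * complex.Re w - complex.Im z * complex.Im w.
Proof. by case: z w => [? ?] []. Qed.
Lemma Im_mulc z w : complex.Im (z * w) = complex.Re z * complex.Im w + complex.Im z * complex.Re w.
Proof. by case: z w => [? ?] []. Qed.

Definition cexp (a b : R) : R[i] := (expR a)%:C * (cos b +i* sin b).

Lemma normc_cis (b : R) : normc (cos b +i* sin b) = 1.
Proof. by rewrite /normc cos2Dsin2 sqrtr1. Qed.

Lemma normc_cexp a b : normc (cexp a b) = expR a.
Proof. by rewrite normcM normc_real normc_cis mulr1 gtr0_norm// expR_gt0. Qed.

Lemma cexpD a b a' b' : cexp (a + a') (b + b') = cexp a b * cexp a' b'.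
Proof.
rewrite /cexp expRD rmorphM mulrACA; congr (_ * _).
by apply/eqP; rewrite eq_complex /= cosD sinD; apply/andP; split; apply/eqP; ring.
Qed.

Lemma cexp0 : cexp 0 0 = 1.
Proof. by rewrite /cexp expR0 cos0 sin0 mul1r. Qed.

Lemma cexp_sum (I : Type) (s : seq I) (F G : I -> R) :
  cexp (\sum_(i <- s) F i) (\sum_(i <- s) G i) = \prod_(i <- s) cexp (F i) (G i).
Proof.
elim: s => [|i s IH]; first by rewrite !big_nil cexp0.
by rewrite !big_cons cexpD IH.
Qed.

End ComplexModulus.

Section ComplexDerivative.
Context {R : realType}.
Implicit Types (f g : R -> R[i]) (x : R) (l k : R[i]).

Definition is_cderive x f l : Prop :=
  is_derive x (1 : R) (fun y => complex.Re (f y)) (complex.Re l) /\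
  is_derive x (1 : R) (fun y => complex.Im (f y)) (complex.Im l).

Lemma is_cderive_eq x f l k : is_cderive x f l -> l = k -> is_cderive x f k.
Proof. by move=> + <-. Qed.

Lemma is_cderive_ext x f g l : f =1 g -> is_cderive x f l -> is_cderive x g l.
Proof. by move=> /funext ->. Qed.

Lemma is_cderive_cst x k : is_cderive x (fun=> k) 0.
Proof. by split; exact: is_derive_cst. Qed.

Lemma is_cderiveD x f g l k : is_cderive x f l -> is_cderive x g k ->
  is_cderive x (fun y => f y + g y) (l + k).
Proof.
move=> [fr fi] [gr gi]; split.
  rewrite Re_addc (_ : (fun _ => _) = (fun y => complex.Re (f y)) + (fun y => complex.Re (g y))); first exact: is_deriveD.
  by apply/funext => y; rewrite Re_addc.
rewrite Im_addc (_ : (fun _ => _) = (fun y => complex.Im (f y)) + (fun y => complex.Im (g y))); first exact: is_deriveD.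
by apply/funext => y; rewrite Im_addc.
Qed.

Lemma is_cderiveM x f g l k : is_cderive x f l -> is_cderive x g k ->
  is_cderive x (fun y => f y * g y) (l * g x + f x * k).
Proof.
move=> [fr fi] [gr gi]; split.
  rewrite (_ : (fun _ => _) = (fun y => complex.Re (f y)) * (fun y => complex.Re (g y)) - (fun y => complex.Im (f y)) * (fun y => complex.Im (g y))); last first.
    by apply/funext => y; rewrite Re_mulc.
  apply: is_derive_eq (is_deriveB (is_deriveM fr gr) (is_deriveM fi gi)) _.
  by rewrite Re_addc !Re_mulc /GRing.scale /=; ring.
rewrite (_ : (fun _ => _) = (fun y => complex.Re (f y)) * (fun y => complex.Im (g y)) + (fun y => complex.Im (f y)) * (fun y => complex.Re (g y))); last first.
  by apply/funext => y; rewrite Im_mulc.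
apply: is_derive_eq (is_deriveD (is_deriveM fr gi) (is_deriveM fi gr)) _.
by rewrite Im_addc !Im_mulc /GRing.scale /=; ring.
Qed.

Lemma is_cderiveMl x k f l : is_cderive x f l -> is_cderive x (fun y => k * f y) (k * l).
Proof.
move=> fl; apply: is_cderive_eq (is_cderiveM (is_cderive_cst x k) fl) _.
by rewrite mul0r add0r.
Qed.

Lemma is_cderive_real x (f : R -> R) (l : R) :
  is_derive x (1 : R) f l -> is_cderive x (fun y => (f y)%:C) l%:C.
Proof. by move=> fl; split => //=; exact: is_derive_cst. Qed.

Lemma is_cderive_sum x (I : Type) (s : seq I) (F : I -> R -> R[i]) (G : I -> R[i]) :
  (forall i, is_cderive x (F i) (G i)) ->
  is_cderive x (fun y => \sum_(i <- s) F i y) (\sum_(i <- s) G i).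
Proof.
move=> FG; elim: s => [|i s IH].
  rewrite big_nil; apply: is_cderive_ext (is_cderive_cst x 0) => y.
  by rewrite big_nil.
rewrite big_cons; apply: is_cderive_ext (is_cderiveD (FG i) IH) => y.
by rewrite big_cons.
Qed.

Lemma is_cderive_cexp x (a b : R -> R) (a' b' : R) :
  is_derive x (1 : R) a a' -> is_derive x (1 : R) b b' ->
  is_cderive x (fun y => cexp (a y) (b y)) ((a' +i* b') * cexp (a x) (b x)).
Proof.
move=> ha hb.
have ea : is_derive x (1:R) (fun y => expR (a y)) (expR (a x) * a').
  by apply: is_derive_eq; rewrite /GRing.scale /= mulrC.
have cb : is_derive x (1:R) (fun y => cos (b y)) (- sin (b x) * b').
  by apply: is_derive_eq; rewrite /GRing.scale /= mulrC.
have sb : is_derive x (1:R) (fun y => sin (b y)) (cos (b x) * b').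
  by apply: is_derive_eq; rewrite /GRing.scale /= mulrC.
apply: is_cderive_eq.
  apply: is_cderiveM; first exact: is_cderive_real ea.
  by instantiate (1 := (- sin (b x) * b') +i* (cos (b x) * b')); split.
by rewrite /cexp; apply/eqP; rewrite eq_complex /=; apply/andP; split; apply/eqP; ring.
Qed.

End ComplexDerivative.

(** * Tensor products of one-variable functions *)

Section TensorProducts.
Context {R : realType} {d : nat}.
Local Notation E := 'rV[R]_d.
Implicit Types (a b : 'I_d -> nat) (x y : E) (k : R[i]).

(** Carrying all derivatives as data turns iterated differentiation into a shift of the index, so
    that partial derivatives of tensor products are explicit. *)
Definition jet (G : nat -> R -> R[i]) : Prop :=
  forall n (s : R), is_cderive s (G n) (G n.+1 s).

Definition tens k (G : 'I_d -> nat -> R -> R[i]) a : E -> R[i] :=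
  fun y => k * \prod_(i < d) G i (a i) (y 0 i).

Definition addmi (i : 'I_d) (n : nat) a : 'I_d -> nat :=
  fun j => (a j + (j == i) * n)%N.

(** The two difference quotients are the same function of [h], so a directional derivative is read
    off from a one-variable one. *)
Lemma is_derive_line (f : E -> R) (g : R -> R) x v (s l : R) :
  (forall h, f (h *: v + x) = g (h *: 1 + s)) ->
  is_derive s (1 : R) g l -> is_derive x v f l.
Proof.
move=> fg [gl <-].
have fx : f x = g s by rewrite -[x]add0r -[0](scale0r v) fg scale0r add0r.
have e : (fun h => h^-1 *: (f (h *: v + x) - f x)) =
         (fun h => h^-1 *: (g (h *: 1 + s) - g s)).
  by apply/funext => h; rewrite fg fx.
by split; rewrite /derivable /derive e.
Qed.

Lemma tens_line k G a x (i : 'I_d) (h : R) :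
  tens k G a (h *: delta_mx 0 i + x) =
  (k * \prod_(j < d | j != i) G j (a j) (x 0 j)) * G i (a i) (h *: 1 + x 0 i).
Proof.
rewrite /tens (bigD1 i)//= !mxE !eqxx mulrCA mulrC; congr (_ * _ * _).
apply: eq_bigr => j ji; rewrite !mxE (negbTE ji) andbF mulr0 add0r//.
Qed.

Lemma tens_derive k G a x (i : 'I_d) : (forall j, jet (G j)) ->
  is_derive x (delta_mx 0 i) (fun y => complex.Re (tens k G a y))
    (complex.Re (tens k G (addmi i 1 a) x)) /\
  is_derive x (delta_mx 0 i) (fun y => complex.Im (tens k G a y))
    (complex.Im (tens k G (addmi i 1 a) x)).
Proof.
move=> GJ.
have [hr hi] := is_cderiveMl (k * \prod_(j < d | j != i) G j (a j) (x 0 j)) (GJ i (a i) (x 0 i)).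
have e : tens k G (addmi i 1 a) x =
    k * \prod_(j < d | j != i) G j (a j) (x 0 j) * G i (a i).+1 (x 0 i).
  rewrite /tens (bigD1 i)//= /addmi eqxx muln1 addn1 mulrCA mulrC.
  congr (_ * _ * _); apply: eq_bigr => j ji; by rewrite (negbTE ji) mul0n addn0.
by rewrite e; split; [apply: is_derive_line hr|apply: is_derive_line hi] => h /=; rewrite tens_line.
Qed.

Lemma partial_tens k G a (i : 'I_d) : (forall j, jet (G j)) ->
  partial i (tens k G a) = tens k G (addmi i 1 a).
Proof.
move=> GJ; apply/funext => x; have [[_ hr] [_ hi]] := tens_derive k a x i GJ.
by rewrite /partial hr hi; case: (tens _ _ _ _).
Qed.

Lemma iter_partial_tens k G a (i : 'I_d) n : (forall j, jet (G j)) ->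
  iter n (partial i) (tens k G a) = tens k G (addmi i n a).
Proof.
move=> GJ; elim: n => [|n IH].
  by congr tens; apply/funext => j; rewrite /addmi muln0 addn0.
rewrite iterS IH partial_tens//; congr tens; apply/funext => j.
by rewrite /addmi muln1 mulnS -addnA [(_ * n + _)%N]addnC.
Qed.

Lemma foldr_partial_tens k G a (s : seq 'I_d) : (forall j, jet (G j)) ->
  foldr partial (tens k G a) s = tens k G (fun j => (a j + count_mem j s)%N).
Proof.
move=> GJ; elim: s => [|i s IH] /=.
  by congr tens; apply/funext => j; rewrite addn0.
rewrite IH partial_tens//; congr tens; apply/funext => j.
by rewrite /addmi muln1 -addnA eq_sym [(_ + (_ == _))%N]addnC.
Qed.

Lemma mpartial_tens k G a b : (forall j, jet (G j)) ->
  mpartial b (tens k G a) = tens k G (fun j => (a j + b j)%N).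
Proof.
move=> GJ; rewrite /mpartial.
(* The multiplicity of [j] in [enum 'I_d], which is 1, is inserted so that the induction can run
   over an arbitrary list. *)
have -> : tens k G (fun j => (a j + b j)%N) =
  tens k G (fun j => (a j + count_mem j (enum 'I_d) * b j)%N).
  congr tens; apply/funext => j.
  by rewrite count_uniq_mem ?enum_uniq// mem_enum mul1n.
elim: (enum _) => [|i s IH] /=.
  by congr tens; apply/funext => j; rewrite mul0n addn0.
rewrite IH iter_partial_tens//; congr tens; apply/funext => j.
rewrite /addmi mulnDl [(_ == i)]eq_sym; case: eqP => [->|_].
  by rewrite !mul1n -addnA [(_ * _ + _)%N]addnC.
by rewrite !mul0n addn0.
Qed.

Lemma is_cderive_continuous (f : R -> R[i]) (f' : R -> R[i]) :
  (forall s : R, is_cderive s f (f' s)) ->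
  continuous (fun s : R => complex.Re (f s)) /\
  continuous (fun s : R => complex.Im (f s)).
Proof.
move=> ff'; split=> s; apply: differentiable_continuous; apply/derivable1_diffP.
  by have [[dr _] _] := ff' s; exact: dr.
by have [_ [di _]] := ff' s; exact: di.
Qed.

Lemma tens_continuous k G a : (forall j, jet (G j)) ->
  continuous (fun x => complex.Re (tens k G a x)) /\
  continuous (fun x => complex.Im (tens k G a x)).
Proof.
move=> GJ; rewrite /tens; elim: (index_enum _) k => [|i s IH] k.
  have -> : (fun x : E => complex.Re (k * \prod_(i <- [::]) G i (a i) (x 0 i))) = cst (complex.Re k).
    by apply/funext => x; rewrite big_nil mulr1.
  have -> : (fun x : E => complex.Im (k * \prod_(i <- [::]) G i (a i) (x 0 i))) = cst (complex.Im k).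
    by apply/funext => x; rewrite big_nil mulr1.
  by split; exact: cst_continuous.
have [hr hi] := IH k.
have [gr gi] := is_cderive_continuous (GJ i (a i)).
have ci : continuous (fun x : E => x 0 i) by exact: coord_continuous.
have gr' : continuous (fun x : E => complex.Re (G i (a i) (x 0 i))).
  by move=> x; apply: (@continuous_comp _ _ _ (fun x : E => x 0 i) (fun s : R => complex.Re (G i (a i) s))); [exact: ci|exact: gr].
have gi' : continuous (fun x : E => complex.Im (G i (a i) (x 0 i))).
  by move=> x; apply: (@continuous_comp _ _ _ (fun x : E => x 0 i) (fun s : R => complex.Im (G i (a i) s))); [exact: ci|exact: gi].
pose H x := k * \prod_(j <- s) G j (a j) (x 0 j).
split => x; rewrite /continuous_at.
  rewrite (_ : (fun y : E => _) = (fun y : E => complex.Re (G i (a i) (y 0 i)) * complex.Re (H y) -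
      complex.Im (G i (a i) (y 0 i)) * complex.Im (H y))); last first.
    by apply/funext => y; rewrite big_cons mulrCA Re_mulc.
  rewrite big_cons mulrCA Re_mulc.
  exact: (cvgB (cvgM (gr' x) (hr x)) (cvgM (gi' x) (hi x))).
rewrite (_ : (fun y : E => _) = (fun y : E => complex.Re (G i (a i) (y 0 i)) * complex.Im (H y) +
    complex.Im (G i (a i) (y 0 i)) * complex.Re (H y))); last first.
  by apply/funext => y; rewrite big_cons mulrCA Im_mulc.
rewrite big_cons mulrCA Im_mulc.
exact: (cvgD (cvgM (gr' x) (hi x)) (cvgM (gi' x) (hr x))).
Qed.

Lemma tens_smooth k G a : (forall j, jet (G j)) -> smooth (tens k G a).
Proof.
move=> GJ s; rewrite foldr_partial_tens//=.
have [cr ci] := tens_continuous k (fun j => (a j + count_mem j s)%N) GJ.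
split => // i x.
have [[dr _] [di _]] := tens_derive k (fun j => (a j + count_mem j s)%N) x i GJ.
by split; [exact: dr|exact: di].
Qed.

Lemma tensZ (l k : R[i]) G a y : tens (l * k) G a y = l * tens k G a y.
Proof. by rewrite /tens mulrA. Qed.

End TensorProducts.

(** * Seminorms of tensor products and continuity of the functional *)

Section SeminormBounds.
Context {R : realType} {d : nat}.
Local Notation E := 'rV[R]_d.
Variables (theta A : R).
Hypothesis A0 : 0 < A.

(** The one-variable Gelfand-Shilov estimate of step [A]; its weights multiply over the coordinates
    to those of [GS_norm]. *)
Definition jet_bounded (M : R) (G : nat -> R -> R[i]) : Prop :=
  forall n k (s : R), normc ((s ^+ n)%:C * G k s) <=
    M * (A ^+ (n + k) * (n`! * k`!)%:R `^ theta).

Lemma powR_prod (I : Type) (s : seq I) (F : I -> R) r : (forall i, 0 <= F i) ->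
  (\prod_(i <- s) F i) `^ r = \prod_(i <- s) F i `^ r.
Proof.
move=> F0; elim: s => [|i s IH]; first by rewrite !big_nil powR1.
by rewrite !big_cons powRM ?IH// prodr_ge0.
Qed.

Lemma GS_norm_tens (k : R[i]) (G : 'I_d -> nat -> R -> R[i]) (M : 'I_d -> R) :
  (forall i, jet (G i)) -> (forall i, jet_bounded (M i) (G i)) ->
  (GS_norm theta A (tens k G (fun=> 0%N)) <= (normc k * \prod_i M i)%:E)%E.
Proof.
move=> GJ GM; apply: ge_ereal_sup => _ [a [b [x ->]]].
rewrite lee_fin mpartial_tens// powRN normcM normc_real.
set fa := (_%:R `^ theta).
have fa0 : 0 < fa by rewrite powR_gt0// ltr0n muln_gt0 !prodn_gt0// => i; rewrite fact_gt0.
have An : 0 < A ^+ (mdeg a + mdeg b) by rewrite exprn_gt0.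
rewrite -mulrA ler_pdivrMl// ler_pdivrMl//.
rewrite /tens normcM normc_prod ![_ * (normc k * _)]mulrCA.
apply: ler_wpM2l; first exact: normc_ge0.
rewrite /monomial normr_prod -big_split /=.
have -> : A ^+ (mdeg a + mdeg b) = \prod_(i < d) A ^+ (a i + b i).
  by rewrite /mdeg -big_split prodrXr.
have -> : fa = \prod_(i < d) ((a i)`! * (b i)`!)%:R `^ theta.
  by rewrite /fa -powR_prod// /mfact -big_split natr_prod.
rewrite -!big_split /=; apply: ler_prod => i _; rewrite mulr_ge0 ?normc_ge0//=.
have := GM i (a i) (b i) (x 0 i); rewrite normcM normc_real => /le_trans; apply.
by rewrite le_eqVlt; apply/orP; left; apply/eqP; ring.
Qed.

Lemma GS_tens (k : R[i]) (G : 'I_d -> nat -> R -> R[i]) (M : 'I_d -> R) :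
  (forall i, jet (G i)) -> (forall i, jet_bounded (M i) (G i)) ->
  GS theta (tens k G (fun=> 0%N)).
Proof.
move=> GJ GM; exists A => //; split; first exact: tens_smooth.
by apply: le_lt_trans (GS_norm_tens k GJ GM) _; rewrite ltry.
Qed.

Variable u : (E -> R[i]) -> R[i].
Hypothesis hu : GS_dual theta u.

Lemma GS_dual_tens_le : exists2 K : R, 0 < K & forall G (M : 'I_d -> R),
  (forall i, jet (G i)) -> (forall i, jet_bounded (M i) (G i)) ->
  (forall i, 0 < M i) ->
  normc (u (tens 1 G (fun=> 0%N))) <= K * \prod_i M i.
Proof.
have [lin cont] := hu.
pose G0 : 'I_d -> nat -> R -> R[i] := fun _ _ _ => 0.
have G0J i : jet (G0 i) by move=> n s; exact: is_cderive_cst.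
have G0b i : jet_bounded 0 (G0 i) by move=> n k s; rewrite mulr0 normc0 mul0r.
have GSz : GS theta (fun _ : E => 0 : R[i]).
  rewrite (_ : (fun _ => _) = tens 0 G0 (fun=> 0%N)); first exact: GS_tens G0J G0b.
  by apply/funext => y; rewrite /tens mul0r.
have uz : u (fun=> 0) = 0.
  have := lin _ _ 0 0 GSz GSz; rewrite !mul0r addr0 => {2}<-.
  by congr u; apply/funext => y; rewrite mul0r addr0.
have [_ /(_ (fun=> 0))] := cont (ball (0 : R[i]^o) 1) (ball_open _ _).
case; first by split => //=; rewrite uz; exact: ballxx.
move=> V [_ _ VA] VU.
have [delta d0 Vd] := VA A A0.
exists (2 / delta); first by rewrite divr_gt0.
move=> G M GJ GM Mp.
have Pp : 0 < \prod_i M i by apply: prodr_gt0.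
(* This scaling brings the norm bound to [delta / 2], strictly inside the ball. *)
pose c : R := delta / (2 * \prod_i M i).
have c0 : 0 < c by rewrite divr_gt0// mulr_gt0.
have GSG := GS_tens 1 GJ GM.
have nb := GS_norm_tens c%:C GJ GM.
have : V (tens c%:C G (fun=> 0%N)).
  apply: Vd; first by split; [exact: tens_smooth|apply: le_lt_trans nb _; rewrite ltry].
  apply: le_lt_trans nb _; rewrite lte_fin normc_real gtr0_norm//.
  rewrite (_ : c * _ = delta / 2); last by rewrite /c; field; rewrite gt_eqF.
  by rewrite ltr_pdivrMr// ltr_pMr// ltr1n.
move/VU => [_ /=]; rewrite /ball /= sub0r normrN normr_normc => h1.
have {h1} : normc (u (fun x => 0 + tens c%:C G (fun=> 0%N) x)) < 1 by rewrite -ltcR; exact: h1.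
have -> : u (fun x => 0 + tens c%:C G (fun=> 0%N) x) = c%:C * u (tens 1 G (fun=> 0%N)).
  have := lin _ _ c%:C 0 GSG GSz; rewrite !mul0r addr0 => <-.
  by congr u; apply/funext => y; rewrite addr0 add0r -tensZ mulr1.
rewrite normcM normc_real gtr0_norm// => h.
apply: ltW; rewrite -(ltr_pM2l c0); apply: lt_le_trans h _.
rewrite (_ : c * _ = 1)// /c; field; rewrite !gt_eqF//.

Qed.

End SeminormBounds.

(** * Polynomials times Gaussians *)

Section PolynomialGaussians.
Context {R : realType}.
Local Notation C := R[i].
Implicit Types (t tau : C) (p q : {poly C}).

(* If [g' = (tau - X) g], then [(q g)' = (hop tau q) g]. *)
Definition hop tau q : {poly C} := q^`() + tau *: q - 'X * q.

Lemma hopD tau p q : hop tau (p + q) = hop tau p + hop tau q.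
Proof. by rewrite /hop derivD scalerDr; ring. Qed.

Lemma hopZ tau (a : C) q : hop tau (a *: q) = a *: hop tau q.
Proof. by rewrite /hop derivZ scalerA mulrC -scalerA -scalerAr !scalerDr scalerN. Qed.

Lemma iter_hopD tau n p q : iter n (hop tau) (p + q) = iter n (hop tau) p + iter n (hop tau) q.
Proof. by elim: n => //= n ->; rewrite hopD. Qed.

Lemma iter_hopZ tau n (a : C) q : iter n (hop tau) (a *: q) = a *: iter n (hop tau) q.
Proof. by elim: n => //= n ->; rewrite hopZ. Qed.

Lemma iter_hop_sum tau n (I : Type) (s : seq I) (F : I -> {poly C}) :
  iter n (hop tau) (\sum_(i <- s) F i) = \sum_(i <- s) iter n (hop tau) (F i).
Proof.
elim: s => [|i s IH]; last by rewrite !big_cons iter_hopD IH.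
by rewrite !big_nil -[0 in LHS](scale0r 0) iter_hopZ scale0r.
Qed.

(** exp (-(s - x)^2/2 + t (s - x) - i s xi): one coordinate of a wave packet times e^(t (s - x)).
    Its logarithmic derivative is t - i xi - (s - x). *)
Definition gexp (x xi : R) t (s : R) : C :=
  cexp (- ((s - x) ^+ 2 / 2) + complex.Re t * (s - x))
       (complex.Im t * (s - x) - s * xi).

(** By the rule for [hop] at the frequency t - i xi, these are the successive derivatives of q(s -
    x) times [gexp]. *)
Definition gjet (x xi : R) t q (n : nat) (s : R) : C :=
  (iter n (hop (t - 0 +i* xi)) q).[(s - x)%:C] * gexp x xi t s.

Lemma is_cderive_horner (x : R) q (s : R) :
  is_cderive s (fun s => q.[(s - x)%:C]) q^`().[(s - x)%:C].
Proof.
have dX : is_cderive s (fun s => (s - x)%:C) 1.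
  have h : is_derive s (1 : R) (fun s => s - x) 1.
    by apply: is_derive_eq; rewrite subr0.
  exact: is_cderive_real h.
elim/poly_ind: q => [|q c IH].
  rewrite deriv0 horner0; apply: is_cderive_ext (is_cderive_cst s 0) => y.
  by rewrite horner0.
apply: is_cderive_eq.
  apply: is_cderive_ext (is_cderiveD (is_cderiveM IH dX) (is_cderive_cst s c)) => y.
  by rewrite hornerMXaddC.
by rewrite derivD derivM derivX derivC !hornerE; ring.
Qed.

Lemma is_cderive_gexp (x xi : R) t (s : R) :
  is_cderive s (gexp x xi t) ((t - 0 +i* xi - (s - x)%:C) * gexp x xi t s).
Proof.
have d0 : is_derive s (1 : R) (fun s => s - x) 1.
  by apply: is_derive_eq; rewrite subr0.
have d1 : is_derive s (1 : R)
    (fun s => - ((s - x) ^+ 2 / 2) + complex.Re t * (s - x)) (- (s - x) + complex.Re t).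
  by apply: is_derive_eq; rewrite /GRing.scale /=; field.
have d2 : is_derive s (1 : R)
    (fun s => complex.Im t * (s - x) - s * xi) (complex.Im t - xi).
  by apply: is_derive_eq; rewrite /GRing.scale /=; ring.
apply: is_cderive_eq (is_cderive_cexp d1 d2) _; congr (_ * _).
case: t {d1 d2} => a b; generalize (s - x) => y.
transitivity ((a - 0 - y) +i* (b - xi - 0)) => //=.
by congr (_ +i* _); ring.
Qed.

Lemma gjet_jet (x xi : R) t q : jet (gjet x xi t q).
Proof.
move=> n s; apply: is_cderive_eq.
  exact: is_cderiveM (is_cderive_horner _ _ _) (is_cderive_gexp _ _ _ _).
rewrite /gjet iterS; set Q := iter _ _ _; rewrite /hop.
rewrite !hornerD hornerN hornerZ hornerM hornerX; move: (gexp _ _ _ _) => g; ring.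
Qed.

Definition sqfact n : R := Num.sqrt (2 ^+ n * n`!%:R).

Lemma sqfact_ge0 n : 0 <= sqfact n. Proof. exact: sqrtr_ge0. Qed.

Lemma exprn_fact_le_expR (z : R) n : 0 <= z -> z ^+ n / n`!%:R <= expR z.
Proof.
move=> z0; case: n => [|n]; first by rewrite expr0 fact0 divr1 -expR0 ler_expR.
by apply: le_trans (expR_ge1Dxn n z0); rewrite lerDr.
Qed.

(** Squared, this is z^n/n! <= e^z at z = s^2/2. Only half of the Gaussian exponent is spent; the
    other half later absorbs e^(Re t (s - x)). *)
Lemma gaussian_moment (s : R) n : `|s| ^+ n * expR (- (s ^+ 2 / 4)) <= sqfact n.
Proof.
rewrite /sqfact -[leLHS]ger0_norm ?mulr_ge0 ?exprn_ge0 ?expR_ge0// -sqrtr_sqr.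
apply: ler_wsqrtr; rewrite exprMn -expRM_natl mulrN expRN.
rewrite ler_pdivrMr ?expR_gt0// exprAC real_normK ?num_real//.
have := @exprn_fact_le_expR (s ^+ 2 / 2) n (divr_ge0 (sqr_ge0 _) (ler0n _ _)).
rewrite ler_pdivrMr ?ltr0n ?fact_gt0// expr_div_n ler_pdivrMr ?exprn_gt0//.
move/le_trans; apply; rewrite (_ : 2 * (s ^+ 2 / 4) = s ^+ 2 / 2); last by field.
by rewrite [leRHS]mulrC mulrA mulrAC.
Qed.

(** Serves the derivative term of [hop]: it lowers the power of X by one where one application of
    [hop] allows a rise by one, and these two units of slack absorb the factor [i]. *)
Lemma sqfactSS n i : (i <= n.+1)%N -> i%:R * sqfact n <= sqfact n.+2.
Proof.
move=> ni; rewrite /sqfact -[i%:R]ger0_norm// -sqrtr_sqr -sqrtrM ?sqr_ge0//.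
apply: ler_wsqrtr; rewrite 2![2 ^+ _.+1]exprS 2!factS !natrM.
rewrite [leRHS](_ : _ = (2 * 2 * (n.+2%:R * n.+1%:R)) * (2 ^+ n * n`!%:R)); last by ring.
apply: ler_wpM2r; first by rewrite mulr_ge0// exprn_ge0.
have h1 : (i%:R : R) <= n.+1%:R by rewrite ler_nat.
have h2 : (n.+2%:R : R) = n.+1%:R + 1 by rewrite -natr1.
have h0 : 0 <= (i%:R : R) by [].
rewrite h2; nra.
Qed.

(** [hop] splits a monomial into three terms, whence 3^b. The prefactor [c] is generalised so that
    the scalars [i] and [tau] met on the way can be moved into it; [k] counts the applications that
    do not multiply by [tau]. *)
Lemma iter_hop_bound tau (s : R) b i j (c Z : R) : 0 <= c ->
  (forall k, (k <= b)%N -> c * normc tau ^+ (b - k) * sqfact (i + j + k) <= Z) ->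
  c * (`|s| ^+ j * normc (iter b (hop tau) 'X^i).[s%:C] * expR (- (s ^+ 2 / 4))) <= 3 ^+ b * Z.
Proof.
elim: b i c Z => [|b IH] i c Z c0 H.
  have := H 0%N isT; rewrite subn0 expr0 mulr1 mul1r addn0; apply: le_trans.
  rewrite /= hornerXn normcX normc_real -exprD; apply: ler_wpM2l => //.
  by rewrite addnC; exact: gaussian_moment.
set e := expR _; set y := `|s| ^+ j.
have e0 : 0 <= e by exact: expR_ge0.
have y0 : 0 <= y by rewrite exprn_ge0.
have T0 : 0 <= normc tau by exact: normc_ge0.
have h2 := IH i (c * normc tau) Z _ _.
have h3 := IH i.+1 c Z c0 _.
have h1 := IH i.-1 (c * i%:R) Z _ _.
have {}h1 : c * i%:R * (y * normc (iter b (hop tau) 'X^(i.-1)).[s%:C] * e) <= 3 ^+ b * Z.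
  apply: h1 => [|k kb]; first by rewrite mulr_ge0.
  have := H k.+1 kb; rewrite subSS; apply: le_trans.
  rewrite -!mulrA; apply: ler_wpM2l => //; rewrite mulrCA; apply: ler_wpM2l.
    by rewrite exprn_ge0.
  case: i {IH H h2 h3} => [|i]; first by rewrite mul0r sqfact_ge0.
  by rewrite /= addnS 2!addSn; apply: sqfactSS; rewrite ltnS -addnA leq_addr.
have {}h2 : c * normc tau * (y * normc (iter b (hop tau) 'X^i).[s%:C] * e) <= 3 ^+ b * Z.
  apply: h2 => [|k kb]; first by rewrite mulr_ge0.
  by have := H k (leqW kb); rewrite subSn// exprS mulrA.
have {}h3 : c * (y * normc (iter b (hop tau) 'X^(i.+1)).[s%:C] * e) <= 3 ^+ b * Z.
  apply: h3 => k kb; have := H k.+1 kb; rewrite subSS addnS !addSn; exact.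
have -> : iter b.+1 (hop tau) 'X^i = i%:R *: iter b (hop tau) 'X^(i.-1) +
    tau *: iter b (hop tau) 'X^i - iter b (hop tau) 'X^(i.+1).
  rewrite iterSr -!iter_hopZ -[- _]scaleN1r -iter_hopZ -!iter_hopD; congr iter.
  by rewrite /hop derivXn -exprS scaleN1r scaler_nat.
rewrite !hornerD hornerN !hornerZ.
set a1 := (iter b _ _).[_] in h1 *; set a2 := (iter b _ _).[_] in h2 *.
set a3 := (iter b _ _).[_] in h3 *.
apply: (@le_trans _ _ (c * (y * (i%:R * normc a1 + normc tau * normc a2 + normc a3) * e))).
  apply: ler_wpM2l => //; apply: ler_wpM2r => //; apply: ler_wpM2l => //.
  apply: le_trans (normcD _ _) _; rewrite normcN; apply: lerD => //.
  by apply: le_trans (normcD _ _) _; rewrite !normcM normc_nat.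
rewrite exprS; nra.
Qed.

End PolynomialGaussians.

(** * Gelfand-Shilov bounds for Gaussian jets, explicit in the base point *)

Section GaussianJetBounds.
Context {R : realType}.
Local Notation C := R[i].
Variables (theta : R).
Hypothesis htheta : 2^-1 <= theta.

Let theta_gt0 : 0 < theta. Proof. by apply: lt_le_trans htheta; rewrite invr_gt0. Qed.

(** With z = (r/B)^(1/theta), (r/B)^j = (z^j)^theta <= (j! e^z)^theta. Enlarging [B] makes the
    exponential loss as slow as desired. *)
Lemma exprn_le_fact_powR (r B : R) j : 0 <= r -> 0 < B ->
  r ^+ j <= B ^+ j * j`!%:R `^ theta * expR (theta * (r / B) `^ theta^-1).
Proof.
move=> r0 B0; set z := (r / B) `^ theta^-1.
have rB : r / B = z `^ theta.
  by rewrite /z -powRrM mulVf ?gt_eqF// powRr1// divr_ge0// ltW.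
have z0 : 0 <= z by exact: powR_ge0.
have h := exprn_fact_le_expR j z0.
rewrite ler_pdivrMr ?ltr0n ?fact_gt0// in h.
have -> : r ^+ j = B ^+ j * (r / B) ^+ j by rewrite -exprMn mulrCA divff ?mulr1 ?gt_eqF.
rewrite -mulrA; apply: ler_wpM2l; first by rewrite exprn_ge0// ltW.
rewrite rB -powR_mulrn ?powR_ge0// -powRrM mulrC powRrM powR_mulrn//.
rewrite [theta * z]mulrC expRM -powRM ?expR_ge0//.
apply: ge0_ler_powR; rewrite ?nnegrE ?exprn_ge0 ?mulr_ge0 ?expR_ge0//; first exact: ltW.
by rewrite mulrC.
Qed.

Lemma bin_le_expn n k : ('C(n, k) <= 2 ^ n)%N.
Proof.
elim: n k => [|n IH] [|k]; rewrite ?bin0 ?expn_gt0//.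
by rewrite binS expnS mul2n -addnn leq_add.
Qed.

Lemma fact_addn_le a b : ((a + b)`! <= 2 ^ (a + b) * (a`! * b`!))%N.
Proof.
rewrite -(@bin_fact (a + b) a) ?leq_addr// addKn leq_mul2r; apply/orP; right.
exact: bin_le_expn.
Qed.

Lemma fact_mul_sub_le l k : (l <= k)%N -> ((k - l)`! * l`! <= k`!)%N.
Proof. by move=> lk; rewrite -(bin_fact lk) mulnC leq_pmull// bin_gt0. Qed.

(** The place where theta >= 1/2 enters the seminorm bounds. *)
Lemma sqrt_fact_le n : Num.sqrt n`!%:R <= n`!%:R `^ theta :> R.
Proof.
rewrite -powR12_sqrt// ler_powR//.
by rewrite ler1n fact_gt0.
Qed.

(** The power [i] of the Taylor variable keeps sqrt(i!) rather than i!^theta, so that dividing by i!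
    in a Taylor remainder gives a null sequence. The 2^m in [sqfact] and two splittings of the
    factorial cost 8^m, at most (3^m)^2. *)
Lemma sqfact_le i n l : sqfact (i + n + l) <=
  3 ^+ i * Num.sqrt i`!%:R * (3 ^+ n * n`!%:R `^ theta) * (3 ^+ l * l`!%:R `^ theta) :> R.
Proof.
have h : sqfact (i + n + l) <= 3 ^+ (i + n + l) * (Num.sqrt i`!%:R * Num.sqrt n`!%:R * Num.sqrt l`!%:R) :> R.
  rewrite /sqfact -[3 ^+ _]ger0_norm ?exprn_ge0// -sqrtr_sqr -!sqrtrM ?mulr_ge0 ?sqr_ge0//.
  apply: ler_wsqrtr; rewrite -exprM -!natrX -!natrM ler_nat.
  set m := (i + n + l)%N.
  apply: (@leq_trans (2 ^ m * (2 ^ m * (2 ^ m * (i`! * n`! * l`!))))%N).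
    rewrite leq_mul2l; apply/orP; right; apply: leq_trans (fact_addn_le _ _) _.
    rewrite leq_mul2l; apply/orP; right; rewrite mulnA leq_mul2r; apply/orP; right.
    apply: leq_trans (fact_addn_le _ _) _; rewrite leq_mul2r leq_exp2l//.
    by rewrite leq_addr orbT.
  have h8 : (2 ^ m * 2 ^ m * 2 ^ m <= 3 ^ (m * 2))%N.
    by case: m => // m; rewrite -!expnMn [(m.+1 * 2)%N]mulnC expnM leq_exp2r.
  by apply: leq_trans (leq_mul h8 (leqnn (i`! * n`! * l`!))); rewrite !mulnA.
apply: le_trans h _; rewrite !exprD.
rewrite [leRHS](_ : _ = 3 ^+ i * 3 ^+ n * 3 ^+ l * (Num.sqrt i`!%:R * n`!%:R `^ theta * l`!%:R `^ theta)); last by ring.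
apply: ler_wpM2l; first by rewrite !mulr_ge0 ?exprn_ge0.
apply: ler_pM => //; rewrite ?mulr_ge0 ?sqrtr_ge0 ?sqrt_fact_le//.
by apply: ler_wpM2l; rewrite ?sqrtr_ge0 ?sqrt_fact_le.
Qed.

Definition growth (rho B : R) : R := expR (theta * (rho / B) `^ theta^-1).

Section bounds.
Variables (x xi rho B : R) (t : C).
Hypotheses (B3 : 3 <= B) (hx : `|x| <= rho) (ht : normc (t - 0 +i* xi) <= rho)
  (ht1 : `|complex.Re t| <= 1).
Local Notation gr := (growth rho B).
Let tau := t - 0 +i* xi.

Let B0 : 0 < B. Proof. exact: lt_le_trans B3. Qed.
Let rho0 : 0 <= rho. Proof. exact: le_trans hx. Qed.
Let X1 : 1 <= gr.
Proof. by rewrite -expR0 ler_expR mulr_ge0 ?powR_ge0// ltW. Qed.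

(** The factors (k - l)!^theta from the powers of [tau] and l!^theta from the Gaussian moment
    recombine below k!^theta. *)
Lemma gaussian_mixed_bound i n k l : (l <= k)%N ->
  normc tau ^+ (k - l) * sqfact (i + n + l) <=
  gr * (3 ^+ i * Num.sqrt i`!%:R) * (3 ^+ n * n`!%:R `^ theta) * (B ^+ k * k`!%:R `^ theta).
Proof.
move=> lk.
have h1 : normc tau ^+ (k - l) <= B ^+ (k - l) * (k - l)`!%:R `^ theta * gr.
  apply: le_trans (exprn_le_fact_powR (k - l) rho0 B0).
  by apply: lerXn2r; rewrite ?nnegrE ?normc_ge0.
have h3 : B ^+ (k - l) * (k - l)`!%:R `^ theta * (3 ^+ l * l`!%:R `^ theta) <= B ^+ k * k`!%:R `^ theta.
  rewrite mulrACA; apply: ler_pM.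
  - by rewrite mulr_ge0 ?exprn_ge0// ltW.
  - by rewrite mulr_ge0 ?powR_ge0.
  - rewrite -[X in _ <= B ^+ X](subnK lk) exprD; apply: ler_wpM2l; first by rewrite exprn_ge0// ltW.
    by apply: lerXn2r; rewrite ?nnegrE// ltW.
  rewrite -powRM//; apply: ge0_ler_powR; rewrite ?nnegrE ?mulr_ge0//; first exact: ltW.
  by rewrite -natrM ler_nat fact_mul_sub_le.
apply: le_trans (ler_pM _ _ h1 (sqfact_le i n l)) _; rewrite ?sqfact_ge0 ?exprn_ge0 ?normc_ge0//.
set a := 3 ^+ i * _; set b := 3 ^+ n * _; set c := 3 ^+ l * _ in h3 *.
set f := B ^+ (k - l) * _ in h3 *; set g := B ^+ k * _ in h3 *.
rewrite [leLHS](_ : _ = gr * a * b * (f * c)); last by ring.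
apply: ler_wpM2l => //; rewrite !mulr_ge0 ?expR_ge0 ?exprn_ge0 ?sqrtr_ge0 ?powR_ge0//.
Qed.

(** Writing s = x + y bounds |s|^n by 2^n (|x|^n + |y|^n). One [gr] pays for |x|^n, the other for
    the powers of [tau]; the 3 in [3 * B] covers the 3^k of [iter_hop_bound] and the 2^n. *)
Lemma gjet_bounded i :
  jet_bounded theta (3 * B) (2 * expR 1 * gr ^+ 2 * (3 ^+ i * Num.sqrt i`!%:R)) (gjet x xi t 'X^i).
Proof.
move=> n k s; rewrite normcM normc_real /gjet normcM normc_cexp -/tau.
set y := s - x; set N := normc _.
have N0 : 0 <= N by exact: normc_ge0.
set e := expR (- (y ^+ 2 / 4)).
have e0 : 0 <= e by exact: expR_ge0.
(* Completing the square: Re t y <= y^2/4 + (Re t)^2, and |Re t| <= 1. *)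
have hexp : expR (- (y ^+ 2 / 2) + complex.Re t * y) <= expR 1 * e.
  rewrite -expRD ler_expR; move: ht1; rewrite ler_norml => /andP[ta tb].
  have r1 : complex.Re t ^+ 2 <= 1 by nra.
  have := sqr_ge0 (y / 2 - complex.Re t); lra.
have hs : `|s ^+ n| <= 2 ^+ n * (`|x| ^+ n + `|y| ^+ n).
  rewrite normrX.
  have sxy : `|s| <= `|x| + `|y| by rewrite -[s in leLHS](subrK x) addrC ler_normD.
  have [xy|yx] := leP `|x| `|y|.
    apply: (@le_trans _ _ ((2 * `|y|) ^+ n)).
      by apply: lerXn2r; rewrite ?nnegrE ?mulr_ge0//; apply: le_trans sxy _; lra.
    by rewrite exprMn; apply: ler_wpM2l; rewrite ?exprn_ge0// lerDr exprn_ge0.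
  apply: (@le_trans _ _ ((2 * `|x|) ^+ n)).
    by apply: lerXn2r; rewrite ?nnegrE ?mulr_ge0//; apply: le_trans sxy _; lra.
  by rewrite exprMn; apply: ler_wpM2l; rewrite ?exprn_ge0// lerDl exprn_ge0.
have hn j : `|y| ^+ j * N * e <= 3 ^+ k * (gr * (3 ^+ i * Num.sqrt i`!%:R) *
     (3 ^+ j * j`!%:R `^ theta) * (B ^+ k * k`!%:R `^ theta)).
  rewrite -[leLHS]mul1r; apply: iter_hop_bound => // l lk; rewrite mul1r.
  exact: gaussian_mixed_bound.
have h0 := hn 0%N; have {}hn := hn n.
rewrite !expr0 !mul1r fact0 powR1 mulr1 in h0.
set S := 3 ^+ i * _ in h0 hn *; set F := n`!%:R `^ theta in hn *.
set K := k`!%:R `^ theta in h0 hn *.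
have F0 : 0 <= F by exact: powR_ge0.
have K0 : 0 <= K by exact: powR_ge0.
have S0 : 0 <= S by rewrite mulr_ge0 ?exprn_ge0 ?sqrtr_ge0.
have X0 : 0 <= gr by exact: expR_ge0.
have hxn : `|x| ^+ n <= B ^+ n * F * gr.
  apply: le_trans (exprn_le_fact_powR n rho0 B0).
  by apply: lerXn2r; rewrite ?nnegrE.
have Bn3 : 3 ^+ n <= B ^+ n by apply: lerXn2r; rewrite ?nnegrE// ltW.
have Bn0 : 0 <= B ^+ n by rewrite exprn_ge0// ltW.
have Bk0 : 0 <= B ^+ k by rewrite exprn_ge0// ltW.
set W := 3 ^+ k * (gr ^+ 2 * S * (B ^+ n * F) * (B ^+ k * K)).
have k30 : 0 <= 3 ^+ k :> R by rewrite exprn_ge0.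
have t1 : `|x| ^+ n * (N * e) <= W.
  apply: le_trans (ler_pM _ _ hxn h0) _; rewrite ?exprn_ge0 ?mulr_ge0//.
  by rewrite /W le_eqVlt; apply/orP; left; apply/eqP; ring.
have t2 : `|y| ^+ n * N * e <= W.
  apply: le_trans hn _; apply: ler_wpM2l => //; apply: ler_wpM2r; first by rewrite mulr_ge0.
  apply: ler_pM; rewrite ?mulr_ge0 ?exprn_ge0//.
    by apply: ler_wpM2r => //; rewrite expr2 ler_pMr// (lt_le_trans ltr01).
  exact: ler_wpM2r.
have n230 : 0 <= 2 ^+ n :> R by rewrite exprn_ge0.
have n23 : 2 ^+ n <= 3 ^+ n :> R by apply: lerXn2r; rewrite ?nnegrE// ler_nat.
have e10 : 0 <= expR 1 :> R by exact: expR_ge0.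
apply: (@le_trans _ _ (2 ^+ n * (`|x| ^+ n + `|y| ^+ n) * (N * (expR 1 * e)))).
  apply: ler_pM => //; first by rewrite mulr_ge0// expR_ge0.
  exact: ler_wpM2l.
have -> : (n`! * k`!)%:R `^ theta = F * K by rewrite natrM powRM.
rewrite [leLHS](_ : _ = 2 ^+ n * (expR 1 * (`|x| ^+ n * (N * e) + `|y| ^+ n * N * e))); last by ring.
rewrite exprMn [leRHS](_ : _ = 3 ^+ n * (expR 1 * (W + W))); last first.
  by rewrite /W !exprD; ring.
have x0 : 0 <= `|x| ^+ n by rewrite exprn_ge0.
have y0 : 0 <= `|y| ^+ n by rewrite exprn_ge0.
apply: ler_pM => //; first by rewrite !mulr_ge0 ?addr_ge0 ?mulr_ge0.
by apply: ler_wpM2l => //; exact: lerD.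
Qed.

End bounds.
End GaussianJetBounds.

(** * Taylor expansion in the complex frequency *)

Section Taylor.
Context {R : realType}.
Local Notation C := R[i].

Lemma is_derive_le (h h' k k' : R -> R) (v : R) : 0 <= v ->
  (forall s, is_derive s (1 : R) h (h' s)) -> (forall s, is_derive s (1 : R) k (k' s)) ->
  (forall s, 0 <= s <= v -> h' s <= k' s) -> h v - h 0 <= k v - k 0.
Proof.
move=> v0 dh dk hk.
have df (s : R) : is_derive s (1 : R) (k - h) (k' s - h' s) by exact: is_deriveB.
have [c + e] : exists2 c, c \in `[0, v] & (k - h) v - (k - h) 0 = (k' c - h' c) * (v - 0).
  apply: (MVT_segment v0 (fun s _ => df s)).
  apply: continuous_subspaceT => s; apply: differentiable_continuous.
  by apply/derivable1_diffP; have [] := df s.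
rewrite in_itv /= => /hk hc; move: e; rewrite !fctE subr0 => e.
have : 0 <= (k' c - h' c) * v by rewrite mulr_ge0// subr_ge0.
by rewrite -e; lra.
Qed.

Lemma is_derive_exprn_fact (n : nat) (s : R) :
  is_derive s (1 : R) (fun v => v ^+ n.+1 / (n.+1)`!%:R) (s ^+ n / n`!%:R).
Proof.
have h : is_derive s (1 : R) (fun v : R => v ^+ n.+1) (n.+1%:R * s ^+ n).
  split; first exact: exprn_derivable.
  by rewrite exp_derive /GRing.scale /= mulr1.
rewrite (_ : (fun v => _) = (n.+1)`!%:R^-1 \*: (fun v : R => v ^+ n.+1)); last first.
  by apply/funext => v; rewrite mulrC.
apply: is_derive_eq; rewrite /GRing.scale /= factS natrM.
by field; rewrite nat1r !pnatr_eq0 -lt0n fact_gt0.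
Qed.

(** Induction by comparing derivatives instead of integrating: the derivative of the remainder is
    the remainder of the shifted sequence, bounded by the derivative of the right-hand side. *)
Lemma taylor_remainder_le (N : nat) (B : R) (g : nat -> R -> R) :
  (forall n s, is_derive s (1 : R) (g n) (g n.+1 s)) ->
  (forall s, 0 <= s <= 1 -> `|g N s| <= B) -> forall v, 0 <= v <= 1 ->
  `|g 0%N v - \sum_(n < N) g n 0 * (v ^+ n / n`!%:R)| <= B * (v ^+ N / N`!%:R).
Proof.
elim: N g => [|N IH] g dg gB v v01.
  by rewrite big_ord0 subr0 expr0 fact0 divr1 mulr1 gB.
pose h v := g 0%N v - \sum_(n < N.+1) g n 0 * (v ^+ n / n`!%:R).
pose h' v := g 1%N v - \sum_(n < N) g n.+1 0 * (v ^+ n / n`!%:R).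
have h'B := IH (fun n => g n.+1) (fun n => dg n.+1) gB.
have dk (s : R) : is_derive s (1 : R) (fun v => B * (v ^+ N.+1 / (N.+1)`!%:R)) (B * (s ^+ N / N`!%:R)).
  have dk := is_derive_exprn_fact N s.
  exact: (@is_deriveZ _ _ _ _ B).
have dh (s : R) : is_derive s (1 : R) h (h' s).
  rewrite /h (_ : (fun v => _) = g 0%N - (cst (g 0%N 0) + \sum_(n < N) (fun v => g n.+1 0 * (v ^+ n.+1 / (n.+1)`!%:R)))); last first.
    apply/funext => w; rewrite big_ord_recl /= expr0 fact0 divr1 mulr1.
    by rewrite !fctE fct_sumE.
  have d1 := dg 0%N s.
  have d2 (n : 'I_N) : is_derive s (1 : R) (fun v => g n.+1 0 * (v ^+ n.+1 / (n.+1)`!%:R))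
      (g n.+1 0 * (s ^+ n / n`!%:R)).
    have dn := is_derive_exprn_fact n s.
    exact: (@is_deriveZ _ _ _ _ (g n.+1 0)).
  have d3 := is_derive_sum d2.
  apply: is_derive_eq (is_deriveB d1 (is_deriveD (is_derive_cst (g 0%N 0) s 1) d3)) _.
  by rewrite add0r.
have /andP[v0 _] := v01.
have h0 : h 0 = 0.
  rewrite /h big_ord_recl /= expr0 fact0 divr1 mulr1 big1 ?addr0 ?subrr// => n _.
  by rewrite expr0n /= mul0r mulr0.
have k0 : B * (0 ^+ N.+1 / (N.+1)`!%:R) = 0 by rewrite expr0n /= mul0r mulr0.
have up := is_derive_le v0 dh dk.
have dn := is_derive_le v0 (fun s => is_deriveN (dh s)) dk.
rewrite -/(h v) ler_norml lerNl; apply/andP; split.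
  move: dn; rewrite k0 !fctE h0 !oppr0 !addr0; apply => s /andP[s0 sv].
  have /h'B : 0 <= s <= 1 by rewrite s0 (le_trans sv)//; case/andP: v01.
  by rewrite ler_norml => /andP[]; rewrite lerNl.
move: up; rewrite k0 h0 !subr0; apply => s /andP[s0 sv].
have /h'B : 0 <= s <= 1 by rewrite s0 (le_trans sv)//; case/andP: v01.
by rewrite ler_norml => /andP[].
Qed.

Lemma ctaylor_remainder_le (N : nat) (B : R) (g : nat -> R -> C) :
  (forall n s, is_cderive s (g n) (g n.+1 s)) ->
  (forall s, 0 <= s <= 1 -> normc (g N s) <= B) ->
  normc (g 0%N 1 - \sum_(n < N) (n`!%:R^-1)%:C * g n 0) <= 2 * B / N`!%:R.
Proof.
move=> dg gB.
have e01 : 0 <= (1 : R) <= 1 by rewrite ler01 lexx.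
have hr := @taylor_remainder_le N B (fun n s => complex.Re (g n s)) (fun n s => (dg n s).1)
   (fun s s01 => le_trans (ler_Re_normc _) (gB s s01)) 1 e01.
have hi := @taylor_remainder_le N B (fun n s => complex.Im (g n s)) (fun n s => (dg n s).2)
   (fun s s01 => le_trans (ler_Im_normc _) (gB s s01)) 1 e01.
apply: le_trans (normc_le_ReIm _) _.
have -> : 2 * B / N`!%:R = B * (1 ^+ N / N`!%:R) + B * (1 ^+ N / N`!%:R).
  by rewrite expr1n mul1r -mulrA mulr_natl mulr2n.
have Rs : complex.Re (\sum_(n < N) (n`!%:R^-1)%:C * g n 0) =
    \sum_(n < N) complex.Re (g n 0) * (1 ^+ n / n`!%:R).
  elim/big_ind2: _ => //= [x1 x2 y1 y2 <- <-|n _]; first by rewrite Re_addc.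
  by rewrite Re_mulc /= mul0r subr0 expr1n mul1r mulrC.
have Is : complex.Im (\sum_(n < N) (n`!%:R^-1)%:C * g n 0) =
    \sum_(n < N) complex.Im (g n 0) * (1 ^+ n / n`!%:R).
  elim/big_ind2: _ => //= [x1 x2 y1 y2 <- <-|n _]; first by rewrite Im_addc.
  by rewrite Im_mulc /= mul0r addr0 expr1n mul1r mulrC.
apply: lerD; first by rewrite Re_addc Re_oppc Rs; exact: hr.
by rewrite Im_addc Im_oppc Is; exact: hi.
Qed.

End Taylor.

(** * Expansion of Gaussian jets in the complex frequency *)

Section TaylorJets.
Context {R : realType}.
Local Notation C := R[i].
Variables (x xi : R) (tau : C).

Let hopv (v : R) : {poly C} -> {poly C} := hop (v%:C * tau - 0 +i* xi).

(** Since hop(X q) - X hop(q) = q, the commutator of the n-th iterate with X is n times the previous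
    iterate, which is also its derivative in the frequency. *)
Lemma is_cderive_iter_hop n q (y v : R) :
  is_cderive v (fun v => (iter n (hopv v) q).[y%:C])
    (tau * ((iter n (hopv v) ('X * q)).[y%:C] - y%:C * (iter n (hopv v) q).[y%:C])).
Proof.
elim: n q => [|n IH] q.
  by rewrite /= hornerM hornerX subrr mulr0; exact: is_cderive_cst.
have split_hop w p : (iter n.+1 (hopv w) p).[y%:C] =
    (iter n (hopv w) (p^`() - 'X * p)).[y%:C] +
    (w%:C * tau - 0 +i* xi) * (iter n (hopv w) p).[y%:C].
  rewrite iterSr -hornerZ -hornerD -iter_hopZ -iter_hopD; congr (iter n _ _).[_].
  by rewrite /hopv /hop; ring.
have dv : is_cderive v (fun v => v%:C * tau - 0 +i* xi) tau.
  have d0 : is_cderive v (fun v => v%:C) 1 by apply: (@is_cderive_real _ v id 1); exact: is_derive_id.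
  apply: is_cderive_eq (is_cderiveD (is_cderiveM d0 (is_cderive_cst v tau)) (is_cderive_cst v _)) _.
  by rewrite mul1r mulr0 !addr0.
apply: is_cderive_eq.
  apply: is_cderive_ext (is_cderiveD (IH (q^`() - 'X * q)) (is_cderiveM dv (IH q))) => w.
  by rewrite split_hop.
rewrite !split_hop derivM derivX mul1r.
have -> : q + 'X * q^`() - 'X * ('X * q) = q + 'X * (q^`() - 'X * q) by ring.
by rewrite (iter_hopD _ n q) hornerD; ring.
Qed.

Lemma is_cderive_gexp_t (s v : R) :
  is_cderive v (fun v => gexp x xi (v%:C * tau) s)
    (tau * (s - x)%:C * gexp x xi (v%:C * tau) s).
Proof.
have eRe w : complex.Re (w%:C * tau) = w * complex.Re tau by rewrite Re_mulc /= mul0r subr0.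
have eIm w : complex.Im (w%:C * tau) = w * complex.Im tau by rewrite Im_mulc /= mul0r addr0.
have d1 : is_derive v (1 : R) (fun v => - ((s - x) ^+ 2 / 2) + v * complex.Re tau * (s - x))
    (complex.Re tau * (s - x)).
  by apply: is_derive_eq; rewrite /GRing.scale /=; ring.
have d2 : is_derive v (1 : R) (fun v => v * complex.Im tau * (s - x) - s * xi)
    (complex.Im tau * (s - x)).
  by apply: is_derive_eq; rewrite /GRing.scale /=; ring.
apply: is_cderive_eq.
  apply: is_cderive_ext (is_cderive_cexp d1 d2) => w.
  by rewrite /gexp eRe eIm.
rewrite /gexp eRe eIm; congr (_ * _).
by case: tau => a b; apply/eqP; rewrite eq_complex /= !mulr0 subr0 add0r !eqxx.
Qed.

(** Along the ray v tau, differentiating e^(t (s - x)) multiplies by tau (s - x), that is by tau X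
    on polynomials. *)
Lemma is_cderive_gjet_t q n (s v : R) :
  is_cderive v (fun v => gjet x xi (v%:C * tau) q n s)
    (tau * gjet x xi (v%:C * tau) ('X * q) n s).
Proof.
apply: is_cderive_eq.
  exact: is_cderiveM (is_cderive_iter_hop n q (s - x) v) (is_cderive_gexp_t s v).
by rewrite /gjet /hopv; move: (gexp _ _ _ _) => g; ring.
Qed.

Definition gjet_remainder (N n : nat) (s : R) : C :=
  gjet x xi tau 1 n s - \sum_(j < N) (tau ^+ j * (j`!%:R^-1)%:C) * gjet x xi 0 'X^j n s.

Lemma gjet_remainder_jet N : jet (gjet_remainder N).
Proof.
move=> n s; rewrite /gjet_remainder -mulN1r.
apply: is_cderive_ext (is_cderiveD (gjet_jet x xi tau 1 n s) (is_cderiveMl (-1)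
  (is_cderive_sum (index_enum 'I_N) (fun j : 'I_N => is_cderiveMl _ (gjet_jet x xi 0 'X^j n s))))) => y.
by rewrite mulN1r.
Qed.

Variables (theta B rho : R).
Hypotheses (htheta : 2^-1 <= theta) (B3 : 3 <= B) (tau1 : normc tau <= 1)
  (hrho : `|x| + `|xi| + 1 <= rho).
Local Notation gr := (growth theta rho B).

Lemma normc_Ni (a : R) : normc (0 +i* a) = `|a|.
Proof. by rewrite /normc expr0n add0r sqrtr_sqr. Qed.

(** The bound decays like 3^N/sqrt(N!) while the step [3 * B] stays fixed. The hypothesis on [rho]
    dominates the frequencies v tau - i xi on the whole ray 0 <= v <= 1. *)
Lemma gjet_remainder_bounded N : jet_bounded theta (3 * B)
  (2 / N`!%:R * (2 * expR 1 * gr ^+ 2 * (3 ^+ N * Num.sqrt N`!%:R))) (gjet_remainder N).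
Proof.
move=> n k s.
pose g j v := (s ^+ n)%:C * (tau ^+ j * gjet x xi (v%:C * tau) 'X^j k s).
have dg j v : is_cderive v (g j) (g j.+1 v).
  apply: is_cderive_eq (is_cderiveMl _ (is_cderiveMl _ (is_cderive_gjet_t _ _ _ _))) _.
  by rewrite /g exprSr -exprS -!mulrA.
have hx : `|x| <= rho by apply: le_trans hrho; rewrite -addrA lerDl addr_ge0.
have gB v : 0 <= v <= 1 -> normc (g N v) <=
    2 * expR 1 * gr ^+ 2 * (3 ^+ N * Num.sqrt N`!%:R) * ((3 * B) ^+ (n + k) * (n`! * k`!)%:R `^ theta).
  move=> /andP[v0 v1].
  have nv : normc (v%:C * tau) <= 1.
    by rewrite normcM normc_real ger0_norm// mulr_ile1// normc_ge0.
  have ht : normc (v%:C * tau - 0 +i* xi) <= rho.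
    apply: le_trans (normcD _ _) _; rewrite normcN normc_Ni; apply: le_trans hrho.
    by have := normr_ge0 x; lra.
  have ht1 : `|complex.Re (v%:C * tau)| <= 1 by apply: le_trans (ler_Re_normc _) nv.
  have := gjet_bounded htheta B3 hx ht ht1 N n k s.
  apply: le_trans; rewrite /g mulrCA normcM normcX.
  by rewrite ler_piMl ?normc_ge0// exprn_ile1// normc_ge0.
have := ctaylor_remainder_le dg gB.
rewrite [X in _ <= X -> _](_ : _ = 2 / N`!%:R * (2 * expR 1 * gr ^+ 2 * (3 ^+ N * Num.sqrt N`!%:R)) *
   ((3 * B) ^+ (n + k) * (n`! * k`!)%:R `^ theta)); last by ring.
apply: le_trans; rewrite /gjet_remainder mulrBr mulr_sumr /g expr0 !mul1r.
rewrite le_eqVlt; apply/orP; left; apply/eqP; congr (normc (_ - _)); apply: eq_bigr => j _.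
by rewrite mul0r; ring.
Qed.

End TaylorJets.

(** * Cauchy estimates *)

Section DiscreteCauchy.
Context {R : realType}.
Local Notation C := R[i].

Let omega N : C := cexp 0 (2 * pi / N%:R).

Let omegaX N m : omega N ^+ m = cexp 0 (m%:R * (2 * pi / N%:R)).
Proof.
elim: m => [|m IH]; first by rewrite mul0r cexp0.
by rewrite exprS IH -cexpD addr0 -natr1; move: (_ / _) => b; congr cexp; ring.
Qed.

Let omegaN N : (0 < N)%N -> omega N ^+ N = 1.
Proof.
move=> N0; have NR : N%:R != 0 :> R by rewrite pnatr_eq0 -lt0n.
rewrite omegaX mulrC divfK// mulr_natl mulr2n /cexp expR0 mul1r.
move: (@cospi R) (@sinpi R); generalize (pi : R) => p cp sp; rewrite cosD sinD cp sp.
by rewrite mulrNN mulr1 !mulr0 !mul0r subr0 addr0.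
Qed.

(** The m-th power has angle 2b with 0 < b < pi; a real part equal to 1 would force sin b = 0. *)
Let omega_neq1 N m : (0 < m < N)%N -> omega N ^+ m != 1.
Proof.
move=> /andP[m0 mN]; have N0 : 0 < N%:R :> R by rewrite ltr0n (leq_trans _ mN).
set b : R := m%:R * (pi / N%:R).
have b0 : 0 < b < pi.
  rewrite /b mulrCA; apply/andP; split.
    by rewrite mulr_gt0 ?pi_gt0// divr_gt0// ltr0n.
  by rewrite gtr_pMr ?pi_gt0// ltr_pdivrMr// mul1r ltr_nat.
have s0 : 0 < sin b by apply: sin_gt0_pi.
rewrite omegaX (_ : m%:R * _ = b + b); last by rewrite /b; field; rewrite gt_eqF.
apply/eqP => /(congr1 (@complex.Re R)).
rewrite Re_mulc /= expR0 mul1r mul0r subr0 cosD => e.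
have := cos2Dsin2 b; nra.
Qed.

Lemma unimodular_root_of_unity N : (0 < N)%N ->
  exists w : C, [/\ normc w = 1, w ^+ N = 1 & forall m, (0 < m < N)%N -> w ^+ m != 1].
Proof.
move=> N0; exists (omega N); split; [|exact: omegaN|exact: omega_neq1].
by rewrite normc_cexp expR0.
Qed.

Lemma sum_roots_of_unity (w : C) N j k : w ^+ N = 1 ->
  (forall m, (0 < m < N)%N -> w ^+ m != 1) -> (j < N)%N -> (k < N)%N -> j != k ->
  \sum_(m < N) (w ^+ j / w ^+ k) ^+ m = 0.
Proof.
move=> wN w1 jN kN jk; set q := _ / _.
have w0 : w != 0.
  apply/eqP => w0; move/eqP: wN; rewrite w0 expr0n; case: N jN {kN w1} => // N _.
  by rewrite eq_sym oner_eq0.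
have qN : q ^+ N = 1.
  by rewrite /q expr_div_n -!exprM ![(_ * N)%N]mulnC !exprM wN !expr1n divr1.
have q1 : q != 1.
  rewrite /q; apply/eqP => /divr1_eq e.
  have lt_neq a b : (a < b < N)%N -> w ^+ a = w ^+ b -> False.
    move=> /andP[ab bN] /eqP; rewrite -(subnKC (ltnW ab)) exprD -[X in X == _]mulr1.
    rewrite (inj_eq (mulfI _)) ?expf_neq0// eq_sym; apply/negP; apply: w1.
    by rewrite subn_gt0 ab (leq_ltn_trans (leq_subr _ _) bN).
  move: jk; rewrite neq_ltn => /orP[h|h]; first by apply: (lt_neq j k) e; rewrite h.
  by apply: (lt_neq k j) (esym e); rewrite h.
apply: (mulfI (_ : q - 1 != 0)); first by rewrite subr_eq0.
by rewrite -subrX1 qN subrr mulr0.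
Qed.

(* Averaging L over the N-th roots of unity on the circle of radius r isolates
   the k-th Taylor coefficient up to the Taylor remainder. *)
Lemma cauchy_estimate (a : nat -> C) (L : C -> C) (r M : R) (eps : nat -> R) (k : nat) :
  0 < r ->
  (forall e, 0 < e -> exists N0, forall N, (N0 <= N)%N -> eps N <= e) ->
  (forall N tau, normc tau <= r ->
     normc (L tau - \sum_(j < N) (tau ^+ j * (j`!%:R^-1)%:C) * a j) <= eps N) ->
  (forall tau, normc tau <= r -> normc (L tau) <= M) ->
  normc (a k) <= k`!%:R / r ^+ k * M.
Proof.
move=> r0 heps hL hM.
have kf0 : 0 < k`!%:R :> R by rewrite ltr0n fact_gt0.
rewrite -ler_pdivrMl ?divr_gt0 ?exprn_gt0//; apply/ler_addgt0Pr => e /heps[N0 hN0].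
(* [N] must exceed [k] for the k-th term to belong to the Taylor polynomial, and [N0] for the
   remainder to be at most [e]. *)
pose N := maxn N0 k.+1; have kN : (k < N)%N by rewrite leq_maxr.
have N0' : (0 < N)%N by exact: leq_trans kN.
have NR : (N%:R : C) != 0 by rewrite pnatr_eq0 -lt0n.
have eN : eps N <= e by apply: hN0; rewrite leq_maxl.
have [w [nw wN w1]] := unimodular_root_of_unity N0'.
have nwX m : normc (w ^+ m) = 1 by rewrite normcX nw expr1n.
pose t (m : 'I_N) : C := r%:C * w ^+ m.
have nt m : normc (t m) = r by rewrite normcM nwX mulr1 normc_real gtr0_norm.
have w0 m : w ^+ m != 0.
  by apply/eqP => w0; have := nwX m; rewrite w0 normc0 => /esym/eqP; rewrite oner_eq0.
pose T (m : 'I_N) := \sum_(j < N) (t m ^+ j * (j`!%:R^-1)%:C) * a j.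
have key : N%:R * ((r ^+ k / k`!%:R)%:C * a k) = \sum_(m < N) (w ^+ k) ^- m * T m.
  rewrite /T; under eq_bigr do rewrite mulr_sumr.
  rewrite exchange_big /= (bigD1 (Ordinal kN))//= [X in _ + X]big1 ?addr0 => [|j jk].
    rewrite (eq_bigr (fun=> (r ^+ k / k`!%:R)%:C * a k)) ?sumr_const ?card_ord ?mulr_natl// => m _.
    rewrite /t exprMn -!exprM [(k * m)%N]mulnC rmorphM rmorphXn.
    by field; rewrite w0 pnatr_eq0 -lt0n fact_gt0.
  rewrite (eq_bigr (fun m : 'I_N => (w ^+ j / w ^+ k) ^+ m *
     ((r%:C ^+ j * (j`!%:R^-1)%:C) * a j))) => [|m _].
    by rewrite -mulr_suml (sum_roots_of_unity wN)// mul0r.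
  rewrite /t exprMn expr_div_n -!exprM [(j * m)%N]mulnC.
  by field; rewrite w0 pnatr_eq0 -lt0n fact_gt0.
have : normc (N%:R * ((r ^+ k / k`!%:R)%:C * a k)) <= N%:R * (M + eps N).
  rewrite key; apply: le_trans (normc_sum _ _ _) _.
  rewrite -[N in leRHS]card_ord mulr_natl -sumr_const; apply: ler_sum => m _.
  rewrite normcM normcV !normcX nw !expr1n invr1 mul1r.
  rewrite -[T m](subKr (L (t m))); apply: le_trans (normcD _ _) _.
  rewrite normcN; apply: lerD; first by apply: hM; rewrite nt.
  by rewrite card_ord; apply: (hL N (t m)); rewrite nt.
rewrite normcM normc_nat ler_pM2l ?ltr0n// normcM normc_real gtr0_norm ?divr_gt0 ?exprn_gt0//.
by rewrite invf_div => /le_trans; apply; rewrite lerD2l.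
Qed.

End DiscreteCauchy.

(** * Linear combinations of bounded jets *)

Section GoodJets.
Context {R : realType}.
Local Notation C := R[i].
Variables (theta : R).
Hypothesis htheta : 2^-1 <= theta.

(** Hides the constant of the bound: this is all that is needed to apply the linearity of [u], which
    [GS_dual] grants on the test space only. *)
Definition good_jet (A : R) (G : nat -> R -> C) : Prop :=
  jet G /\ exists2 M, 0 < M & jet_bounded theta A M G.

Lemma good_jetD A (k : C) G H : 0 < A -> good_jet A G -> good_jet A H ->
  good_jet A (fun n s => G n s + k * H n s).
Proof.
move=> A0 [GJ [M M0 GM]] [HJ [N N0 HN]]; split.
  by move=> n s; exact: is_cderiveD (GJ n s) (is_cderiveMl k (HJ n s)).
exists (M + normc k * N); first by rewrite ltr_wpDr// mulr_ge0 ?normc_ge0// ltW.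
move=> n l s; rewrite mulrDr; apply: le_trans (normcD _ _) _.
rewrite mulrDl; apply: lerD; first exact: GM.
by rewrite mulrCA normcM -mulrA; apply: ler_wpM2l; rewrite ?normc_ge0.
Qed.

Lemma good_jet0 A : 0 < A -> good_jet A (fun _ _ => 0).
Proof.
move=> A0; split; first by move=> n s; exact: is_cderive_cst.
exists 1 => // n l s; rewrite mulr0 normc0 mul1r mulr_ge0 ?powR_ge0// exprn_ge0// ltW//.
Qed.

Lemma gjetD (x xi : R) t (p q : {poly C}) (k : C) n s :
  gjet x xi t (p + k *: q) n s = gjet x xi t p n s + k * gjet x xi t q n s.
Proof. by rewrite /gjet iter_hopD iter_hopZ hornerD hornerZ mulrDl -mulrA. Qed.

Lemma gjet_sumXn (x xi : R) t (q : {poly C}) N n s : (size q <= N)%N ->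
  gjet x xi t q n s = \sum_(k < N) q`_k * gjet x xi t 'X^k n s.
Proof.
move=> sq.
have {1}-> : q = \sum_(k < N) q`_k *: 'X^k.
  rewrite -(poly_def N (nth 0 q)); apply/polyP => k; rewrite coef_poly.
  by case: ltnP => // Nk; rewrite nth_default// (leq_trans sq).
rewrite /gjet iter_hop_sum horner_sum mulr_suml; apply: eq_bigr => k _.
by rewrite iter_hopZ hornerZ mulrA.
Qed.

Lemma good_jet_sum (I : Type) (s : seq I) (c : I -> C) (G : I -> nat -> R -> C) (A : R) :
  0 < A -> (forall i, good_jet A (G i)) ->
  good_jet A (fun n y => \sum_(i <- s) c i * G i n y).
Proof.
move=> A0 gG; elim: s => [|i s IH].
  rewrite (_ : (fun _ _ => _) = (fun _ _ => 0)); first exact: good_jet0.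
  by apply/funext => n; apply/funext => y; rewrite big_nil.
rewrite (_ : (fun _ _ => _) = (fun n y => \sum_(i <- s) c i * G i n y + c i * G i n y)).
  exact: good_jetD.
by apply/funext => n; apply/funext => y; rewrite big_cons addrC.
Qed.

Lemma gjet_good (x xi B : R) t (q : {poly C}) : 3 <= B -> `|complex.Re t| <= 1 ->
  good_jet (3 * B) (gjet x xi t q).
Proof.
move=> B3 t1; have B0 : 0 < 3 * B by rewrite mulr_gt0// (lt_le_trans _ B3).
rewrite (_ : gjet x xi t q = (fun n s => \sum_(k < size q) q`_k * gjet x xi t 'X^k n s)).
  apply: good_jet_sum => // k; split; first exact: gjet_jet.
  have hx : `|x| <= `|x| + normc (t - 0 +i* xi) by rewrite lerDl normc_ge0.
  have ht : normc (t - 0 +i* xi) <= `|x| + normc (t - 0 +i* xi) by rewrite lerDr.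
  have h := gjet_bounded htheta B3 hx ht t1 k.
  eexists; last exact: h.
  by rewrite !mulr_gt0 ?expR_gt0 ?exprn_gt0 ?expR_gt0 ?sqrtr_gt0 ?ltr0n ?fact_gt0.
by apply/funext => n; apply/funext => s; exact: gjet_sumXn.
Qed.

Lemma gjet_remainder_good (x xi B : R) t N : 3 <= B -> normc t <= 1 ->
  good_jet (3 * B) (gjet_remainder x xi t N).
Proof.
move=> B3 t1; split; first exact: gjet_remainder_jet.
have h := gjet_remainder_bounded htheta B3 t1 (lexx (`|x| + `|xi| + 1)) N.
eexists; last exact: h.
by rewrite !mulr_gt0 ?invr_gt0 ?expR_gt0 ?exprn_gt0 ?expR_gt0 ?sqrtr_gt0 ?ltr0n ?fact_gt0.
Qed.

(** 3^N/sqrt(N!) is the square root of 9^N/N!, a term of the convergent exponential series. *)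
Lemma sqrt_fact_lim (K e : R) : 0 < e -> exists N0, forall N, (N0 <= N)%N ->
  K * (2 / N`!%:R * (3 ^+ N * Num.sqrt N`!%:R)) <= e.
Proof.
move=> e0; pose K' := `|K| * 2 + 1.
have K'0 : 0 < K' by rewrite ltr_wpDl// mulr_ge0.
have d0 : 0 < (e / K') ^+ 2 by rewrite exprn_gt0// divr_gt0.
have /cvgrPdist_lt/(_ _ d0)[N0 _ hN] := @cvg_exp_coeff R 9.
exists N0 => N /hN; rewrite sub0r normrN /exp_coeff.
rewrite ger0_norm ?divr_ge0 ?exprn_ge0// => h.
have f0 : 0 < N`!%:R :> R by rewrite ltr0n fact_gt0.
have sq : N`!%:R^-1 * (3 ^+ N * Num.sqrt N`!%:R) = Num.sqrt (9 ^+ N / N`!%:R) :> R.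
  rewrite -[LHS]ger0_norm ?mulr_ge0 ?invr_ge0 ?exprn_ge0 ?sqrtr_ge0// -sqrtr_sqr.
  congr Num.sqrt; rewrite !exprMn sqr_sqrtr ?ltW// -exprM mulnC exprM (_ : 3 ^+ 2 = 9); last by ring.
  by field; rewrite gt_eqF.
have {}h : Num.sqrt (9 ^+ N / N`!%:R) <= e / K'.
  have ek : 0 <= e / K' by apply: divr_ge0; exact: ltW.
  by rewrite -[leRHS](ger0_norm ek) -sqrtr_sqr; apply: ler_wsqrtr; exact: ltW.
rewrite -[2 / _ * _]mulrA sq mulrA.
apply: (@le_trans _ _ (K' * (e / K'))); last by rewrite mulrC divfK ?gt_eqF.
apply: le_trans (_ : K' * Num.sqrt (9 ^+ N / N`!%:R) <= _); last by rewrite ler_pM2l.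
apply: ler_wpM2r; rewrite ?sqrtr_ge0// /K'.
by have := ler_norm K; lra.
Qed.

End GoodJets.

(** * Symbol calculus on coefficients *)

Section WeightedCoefficientNorm.
Context {R : realType}.
Local Notation C := R[i].
Variables (n : nat) (r : R).
Hypothesis r0 : 0 < r.
Implicit Types p q : {poly C}.

(* The weights are those of the Cauchy estimates on a disc of radius r. *)
Definition wnorm p : R := \sum_(k < n) normc p`_k * (k`!%:R / r ^+ k).

Let w_ge0 k : 0 <= k`!%:R / r ^+ k :> R.
Proof. by rewrite divr_ge0// exprn_ge0// ltW. Qed.

Lemma wnorm_ge0 p : 0 <= wnorm p.
Proof. by apply: sumr_ge0 => k _; rewrite mulr_ge0 ?normc_ge0. Qed.

Lemma wnormD p q : wnorm (p + q) <= wnorm p + wnorm q.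
Proof.
rewrite /wnorm -big_split; apply: ler_sum => k _ /=; rewrite -mulrDl.
by apply: ler_wpM2r => //; rewrite coefD normcD.
Qed.

Lemma wnormZ a p : wnorm (a *: p) = normc a * wnorm p.
Proof.
by rewrite /wnorm mulr_sumr; apply: eq_bigr => k _; rewrite coefZ normcM mulrA.
Qed.

Lemma wnormN p : wnorm (- p) = wnorm p.
Proof. by apply: eq_bigr => k _; rewrite coefN normcN. Qed.

Lemma wnormC_le a : wnorm a%:P <= normc a.
Proof.
rewrite /wnorm; case: n => [|N]; first by rewrite big_ord0 normc_ge0.
rewrite big_ord_recl coefC /= expr0 fact0 divr1 mulr1 big1 ?addr0// => k _.
by rewrite coefC /= normc0 mul0r.
Qed.

(** Moving a coefficient from k to k + 1 multiplies its weight by (k + 1)/r, at most n/r within the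
    truncation. *)
Lemma wnorm_mulX p : wnorm ('X * p) <= n%:R / r * wnorm p.
Proof.
rewrite /wnorm; case: n => [|N]; first by rewrite !big_ord0 mulr0.
rewrite big_ord_recl coefXM /= normc0 mul0r add0r big_ord_recr /= mulrDr.
apply: ler_wpDr; first by rewrite mulr_ge0 ?(mulr_ge0 (normc_ge0 _) (w_ge0 _))// divr_ge0// ltW.
rewrite mulr_sumr; apply: ler_sum => k _; rewrite coefXM /= /bump /= add1n /=.
rewrite [leRHS]mulrCA; apply: ler_wpM2l; first exact: normc_ge0.
rewrite factS natrM exprS invfM [leLHS](_ : _ = k.+1%:R / r * (k`!%:R / r ^+ k)).
  apply: ler_wpM2r => //; apply: ler_wpM2r; first by rewrite invr_ge0 ltW.
  by rewrite ler_nat ltnS ltnW.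
by ring.
Qed.

(** (k + 1) k!/r^k = r (k + 1)!/r^(k + 1), so a derivative costs r; the size condition ensures that
    no coefficient enters from beyond the truncation. *)
Lemma wnorm_deriv p : (size p <= n)%N -> wnorm p^`() <= r * wnorm p.
Proof.
move=> sp; have e : wnorm p = \sum_(k < n.+1) normc p`_k * (k`!%:R / r ^+ k).
  by rewrite big_ord_recr /= [p`_n]nth_default// normc0 mul0r addr0.
rewrite e big_ord_recl mulrDr; apply: ler_wpDl.
  by rewrite mulr_ge0 ?(mulr_ge0 (normc_ge0 _) (w_ge0 _))// ltW.
rewrite mulr_sumr; apply: ler_sum => k _; rewrite coef_deriv lift0 -[p`_k.+1 *+ _]mulr_natr.
rewrite normcM normc_nat factS natrM exprS invfM le_eqVlt; apply/orP; left; apply/eqP.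
by field; rewrite expf_neq0 gt_eqF.
Qed.

(* In the application [p] is the polynomial in y - x produced by [s] factors y_j
   or D_j acting on a wave packet, and [c] is its principal part, the product of
   the corresponding coordinates of (x, xi); the bounds survive one more factor. *)
Variables (rho eta : R).
Hypotheses (rho0 : 0 <= rho) (eta0 : 0 <= eta) (hre : r + n%:R / r <= rho * eta).

Definition near_const (s : nat) (c : C) (p : {poly C}) : Prop :=
  [/\ (size p <= s.+1)%N, wnorm p <= (rho * (1 + eta)) ^+ s, normc c <= rho ^+ s &
      wnorm (p - c%:P) <= (rho * (1 + eta)) ^+ s - rho ^+ s].

(** The error bound reproduces itself because (rho (1 + eta))^(s+1) - rho^(s+1) is rho times the old
    error bound plus rho eta (rho (1 + eta))^s, the share of [delta]. *)
Lemma near_const_step s c p (kappa : C) (delta : {poly C}) :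
  near_const s c p -> normc kappa <= rho -> (size delta <= s.+2)%N ->
  wnorm delta <= rho * eta * wnorm p ->
  near_const s.+1 (kappa * c) (kappa *: p + delta).
Proof.
move=> [sp np nc npc] nk sd nd; have nk0 := normc_ge0 kappa.
have np0 := wnorm_ge0 p; have npc0 := wnorm_ge0 (p - c%:P).
split.
- rewrite (leq_trans (size_polyD _ _))// geq_max sd andbT.
  by rewrite (leq_trans (size_scale_leq _ _))// (leq_trans sp).
- apply: le_trans (wnormD _ _) _; rewrite wnormZ exprS.
  apply: (@le_trans _ _ (rho * (1 + eta) * wnorm p)).
    by rewrite mulrDr mulr1 mulrDl; apply: lerD => //; apply: ler_wpM2r.
  by apply: ler_wpM2l => //; rewrite mulr_ge0// addr_ge0.
- by rewrite normcM exprS; apply: ler_pM => //; exact: normc_ge0.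
- have -> : kappa *: p + delta - (kappa * c)%:P = kappa *: (p - c%:P) + delta.
    by rewrite scalerBr -!mul_polyC polyCM; ring.
  apply: le_trans (wnormD _ _) _; rewrite wnormZ.
  have h1 : normc kappa * wnorm (p - c%:P) <= rho * ((rho * (1 + eta)) ^+ s - rho ^+ s).
    exact: ler_pM.
  have h2 : rho * eta * wnorm p <= rho * eta * (rho * (1 + eta)) ^+ s.
    by apply: ler_wpM2l => //; rewrite mulr_ge0.
  rewrite [leRHS](_ : _ = rho * ((rho * (1 + eta)) ^+ s - rho ^+ s) +
     rho * eta * (rho * (1 + eta)) ^+ s); last by rewrite !exprS; ring.
  by apply: lerD => //; exact: le_trans nd h2.
Qed.

Lemma near_const_mulX s c p (x : R) : `|x| <= rho -> (s.+1 < n)%N ->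
  near_const s c p -> near_const s.+1 (x%:C * c) (('X + x%:C%:P) * p).
Proof.
move=> hx sn h; have [sp _ _ _] := h.
rewrite mulrDl mul_polyC addrC; apply: (near_const_step h); first by rewrite normc_real.
  by rewrite (leq_trans (size_polyMleq _ _))// size_polyX.
apply: le_trans (wnorm_mulX p) _; apply: ler_wpM2r; first exact: wnorm_ge0.
by apply: le_trans hre; rewrite lerDr ltW.
Qed.

Lemma near_const_hop s c p (tau : C) : normc tau <= rho -> (s.+1 < n)%N ->
  near_const s c p -> near_const s.+1 (tau * c) (hop tau p).
Proof.
move=> ht sn h; have [sp _ _ _] := h.
rewrite /hop (_ : _ - _ = tau *: p + (p^`() - 'X * p)); last by ring.
apply: (near_const_step h) => //.
  rewrite (leq_trans (size_polyD _ _))// geq_max size_polyN; apply/andP; split.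
    by rewrite (leq_trans (size_poly _ _))// (leq_trans (leq_pred _))// (leq_trans sp).
  by rewrite (leq_trans (size_polyMleq _ _))// size_polyX.
apply: le_trans (wnormD _ _) _; rewrite wnormN.
apply: (@le_trans _ _ ((r + n%:R / r) * wnorm p)).
  rewrite mulrDl; apply: lerD; last exact: wnorm_mulX.
  by apply: wnorm_deriv; rewrite (leq_trans sp)// ltnW.
by apply: ler_wpM2r => //; exact: wnorm_ge0.
Qed.

Lemma near_const_symbol a b (x : R) (tau : C) :
  `|x| <= rho -> normc tau <= rho -> (a + b < n)%N ->
  near_const (a + b) (tau ^+ a * x%:C ^+ b) (iter a (hop tau) (('X + x%:C%:P) ^+ b)).
Proof.
move=> hx ht; elim: a => [|a IH] abn.
  rewrite mul1r add0n /= in abn *; elim: b abn => [|b IH] bn.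
    rewrite !expr0; split.
    - by rewrite size_poly1.
    - by rewrite expr0; apply: le_trans (wnormC_le 1) _; rewrite normc1.
    - by rewrite expr0 normc1.
    - rewrite subrr !expr0 subrr -(scale0r 0) wnormZ normc0 mul0r //.
  by rewrite !exprS; apply: near_const_mulX => //; apply: IH; exact: ltnW.
rewrite addSn exprS -mulrA; apply: near_const_hop => //; apply: IH.
by rewrite ltnW.
Qed.

End WeightedCoefficientNorm.

(** * Cauchy estimates for the functional *)

Section Slots.
Context {R : realType} {d : nat}.
Local Notation E := 'rV[R]_d.
Local Notation C := R[i].
Variables (theta : R) (u : (E -> C) -> C).
Hypotheses (htheta : 2^-1 <= theta) (hu : GS_dual theta u).
Implicit Types (G : 'I_d -> nat -> R -> C) (H : nat -> R -> C).

Definition upd G (j : 'I_d) H : 'I_d -> nat -> R -> C :=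
  fun i => if i == j then H else G i.

Definition upair G : C := u (tens 1 G (fun=> 0%N)).

Lemma tens_upd k G j H y :
  tens k (upd G j H) (fun=> 0%N) y = k * (\prod_(i < d | i != j) G i 0%N (y 0 i)) * H 0%N (y 0 j).
Proof.
rewrite /tens (bigD1 j)//= /upd eqxx mulrCA [RHS]mulrC; congr (_ * (_ * _)).
by apply: eq_bigr => i /negbTE ->.
Qed.

Lemma good_upd A G j H : (forall i, good_jet theta A (G i)) -> good_jet theta A H ->
  forall i, good_jet theta A (upd G j H i).
Proof. by move=> gG gH i; rewrite /upd; case: eqP. Qed.

Lemma GS_good k G A : 0 < A -> (forall i, good_jet theta A (G i)) ->
  GS theta (tens k G (fun=> 0%N)).
Proof.
move=> A0 gG; have /choice[M hM] : forall i, exists M, 0 < M /\ jet_bounded theta A M (G i).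
  by move=> i; have [_ [M M0 h]] := gG i; exists M.
apply: (@GS_tens _ _ _ A A0 k G M) => i; first by have [] := gG i.
by have [] := hM i.
Qed.

Lemma upair_scale k G A : 0 < A -> (forall i, good_jet theta A (G i)) ->
  u (tens k G (fun=> 0%N)) = k * upair G.
Proof.
move=> A0 gG; have [lin _] := hu.
have g1 := GS_good 1 A0 gG.
have := lin _ _ k 0 g1 g1; rewrite mul0r addr0 => <-.
by congr u; apply/funext => y; rewrite mul0r addr0 -tensZ mulr1.
Qed.

Lemma upair_add A G j H1 H2 (c : C) : 0 < A -> (forall i, good_jet theta A (G i)) ->
  good_jet theta A H1 -> good_jet theta A H2 ->
  upair (upd G j (fun n s => H1 n s + c * H2 n s)) =
  upair (upd G j H1) + c * upair (upd G j H2).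
Proof.
move=> A0 gG g1 g2; have [lin _] := hu.
have := lin _ _ 1 c (GS_good 1 A0 (good_upd j gG g1)) (GS_good 1 A0 (good_upd j gG g2)).
rewrite mul1r => <-; congr u; apply/funext => y.
by rewrite !tens_upd; ring.
Qed.

Lemma upair_sum (I : Type) (s : seq I) A G j (H : I -> nat -> R -> C) (c : I -> C) :
  0 < A -> (forall i, good_jet theta A (G i)) -> (forall l, good_jet theta A (H l)) ->
  upair (upd G j (fun n y => \sum_(l <- s) c l * H l n y)) =
  \sum_(l <- s) c l * upair (upd G j (H l)).
Proof.
move=> A0 gG gH; elim: s => [|l s IH].
  rewrite big_nil (_ : (fun _ _ => _) = (fun n y => 0 + (-1) * (fun _ _ => 0 : C) n y)).
    rewrite (@upair_add A)//; [|exact: good_jet0|exact: good_jet0].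
    by rewrite mulN1r subrr.
  by apply/funext => n; apply/funext => y; rewrite big_nil mulr0 addr0.
rewrite big_cons -IH addrC -(@upair_add A)//; last exact: good_jet_sum.
congr (upair (upd _ _ _)); apply/funext => n; apply/funext => y.
by rewrite big_cons addrC.
Qed.

Variables (x xi : E).
Local Notation J t q := (fun i : 'I_d => gjet (x 0 i) (xi 0 i) (t i) (q i)).
Local Notation gj i t q := (gjet (x 0 i) (xi 0 i) t q).

Let A9 : 0 < 3 * 3 :> R. Proof. by rewrite mulr_gt0. Qed.
Let gg i t (q : {poly C}) : `|complex.Re t| <= 1 -> good_jet theta (3 * 3) (gj i t q).
Proof. exact: gjet_good. Qed.
Let gg0 i (q : {poly C}) : good_jet theta (3 * 3) (gj i 0 q).
Proof. by apply: gg; rewrite /= normr0. Qed.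

(** With the other slots frozen, the pairing is a function of tau whose derivatives at 0 are the
    pairings with X^k; their Cauchy bounds are the weights of [wnorm]. *)
Lemma slot_cauchy G j (r M : R) (q : {poly C}) (n : nat) :
  (forall i, good_jet theta (3 * 3) (G i)) -> 0 < r <= 1 -> (size q <= n)%N ->
  (forall tau, normc tau <= r -> normc (upair (upd G j (gj j tau 1))) <= M) ->
  normc (upair (upd G j (gj j 0 q))) <= wnorm n r q * M.
Proof.
move=> gG /andP[r0 r1] sq hM.
have /choice[MM hMM] : forall i, exists M, 0 < M /\ jet_bounded theta (3 * 3) M (G i).
  by move=> i; have [_ [N N0 h]] := gG i; exists N.
have [K K0 hK] := GS_dual_tens_le A9 hu.
pose rho := `|x 0 j| + `|xi 0 j| + 1.
pose P := \prod_(i < d | i != j) MM i.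
(* The constant of [gjet_remainder_bounded] for the least admissible [B = 3], to which the step
   [3 * 3] belongs. *)
pose rest N : R := 2 / N`!%:R * (2 * expR 1 * growth theta rho 3 ^+ 2 * (3 ^+ N * Num.sqrt N`!%:R)).
have rest0 N : 0 < rest N.
  by rewrite /rest !mulr_gt0 ?invr_gt0 ?expR_gt0 ?exprn_gt0 ?expR_gt0 ?sqrtr_gt0 ?ltr0n ?fact_gt0.
have hXk k : normc (upair (upd G j (gj j 0 'X^k))) <= k`!%:R / r ^+ k * M.
  apply: (@cauchy_estimate R (fun k => upair (upd G j (gj j 0 'X^k)))
    (fun tau => upair (upd G j (gj j tau 1))) r M (fun N => K * (rest N * P)) k r0) => //.
    move=> e /(sqrt_fact_lim (K * P * (2 * expR 1 * growth theta rho 3 ^+ 2)))[N0 hN0].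
    exists N0 => N /hN0; apply: le_trans; rewrite le_eqVlt; apply/orP; left; apply/eqP.
    by rewrite /rest; ring.
  move=> N tau ht; have t1 : normc tau <= 1 by apply: le_trans r1.
  have tR : `|complex.Re tau| <= 1 by apply: le_trans (ler_Re_normc _) t1.
  have -> : upair (upd G j (gj j tau 1)) -
      \sum_(l < N) tau ^+ l * (l`!%:R^-1)%:C * upair (upd G j (gj j 0 'X^l)) =
      upair (upd G j (gjet_remainder (x 0 j) (xi 0 j) tau N)).
    rewrite -(@upair_sum _ _ (3 * 3))// -mulN1r -(@upair_add (3 * 3))//; [|exact: gg|exact: good_jet_sum].
    congr (upair (upd _ _ _)); apply/funext => k'; apply/funext => y.
    by rewrite /gjet_remainder mulN1r.
  have := hK (upd G j (gjet_remainder (x 0 j) (xi 0 j) tau N)) (fun i => if i == j then rest N else MM i).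
  rewrite (bigD1 j)//= eqxx (eq_bigr MM) => [|i /negbTE ->//]; apply.
  - by move=> i; have [] := good_upd j gG (gjet_remainder_good htheta (x 0 j) (xi 0 j) N (lexx 3) t1) i.
  - move=> i; rewrite /upd; case: eqP => _; last by have [] := hMM i.
    exact: gjet_remainder_bounded.
  - by move=> i; case: eqP => _ //; have [] := hMM i.
have -> : upair (upd G j (gj j 0 q)) = \sum_(k < n) q`_k * upair (upd G j (gj j 0 'X^k)).
  rewrite -(@upair_sum _ _ (3 * 3))//; congr (upair (upd _ _ _)); apply/funext => k; apply/funext => y.
  exact: gjet_sumXn.
apply: le_trans (normc_sum _ _ _) _; rewrite /wnorm mulr_suml; apply: ler_sum => k _.
by rewrite normcM -mulrA; apply: ler_wpM2l => //; exact: normc_ge0.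
Qed.

Lemma all_slots_cauchy (r M : R) (q : 'I_d -> {poly C}) (n : nat) :
  0 < r <= 1 -> (forall i, (size (q i) <= n)%N) ->
  (forall t, (forall i, normc (t i) <= r) -> normc (upair (J t (fun=> 1))) <= M) ->
  normc (upair (J (fun=> 0) q)) <= \prod_i wnorm n r (q i) * M.
Proof.
move=> hr sq hM; have /andP[r0 r1] := hr.
(* Slots below [k] already carry their polynomial at frequency 0; the others still carry a free
   complex exponential. *)
pose D k (t : 'I_d -> C) := fun i : 'I_d => if (i < k)%N then gj i 0 (q i) else gj i (t i) 1.
have tRe t i : normc t <= r -> good_jet theta (3 * 3) (gj i t 1).
  by move=> ht; apply: gg; apply: le_trans (ler_Re_normc _) _; exact: le_trans r1.
suff H k : (k <= d)%N -> forall t, (forall i, normc (t i) <= r) ->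
    normc (upair (D k t)) <= \prod_(i < d | (i < k)%N) wnorm n r (q i) * M.
  rewrite (eq_bigl (fun i : 'I_d => (i < d)%N)) => [|i]; last by rewrite ltn_ord.
  rewrite (_ : J (fun=> 0) q = D d (fun=> 0)); last by apply/funext => i; rewrite /D ltn_ord.
  by apply: H => // i; rewrite normc0 ltW.
elim: k => [|k IH] kd t ht.
  rewrite big_pred0 ?mul1r => [|i]; last by rewrite ltn0.
  by apply: hM.
pose j := Ordinal kd.
have -> : D k.+1 t = upd (D k t) j (gj j 0 (q j)).
  apply/funext => i; rewrite /upd /D; case: eqP => [->|/eqP ij]; first by rewrite ltnSn.
  by rewrite ltnS leq_eqVlt -[i == k :> nat]/(i == j) (negbTE ij).
rewrite (bigD1 j)//=.
rewrite (eq_bigl (fun i : 'I_d => (i < k)%N)) => [|i]; last first.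
  by rewrite ltnS andbC leq_eqVlt -[i == k :> nat]/(i == j); case: eqP => //= ->; rewrite ltnn.
rewrite -mulrA; apply: slot_cauchy => //.
  by move=> i; rewrite /D; case: ifP => _ //; apply: tRe.
move=> tau htau.
have -> : upd (D k t) j (gj j tau 1) = D k (fun i => if i == j then tau else t i).
  apply/funext => i; rewrite /upd /D; case: eqP => [->|//].
  by rewrite ltnn.
by apply: IH => [|i]; [exact: ltnW|case: eqP].
Qed.

Lemma upair_const (c : 'I_d -> C) :
  upair (J (fun=> 0) (fun i => (c i)%:P)) = (\prod_i c i) * upair (J (fun=> 0) (fun=> 1)).
Proof.
have e := @upair_scale (\prod_i c i) (J (fun=> 0) (fun=> 1)) _ A9 (fun i => gg0 i 1).
transitivity (u (tens (\prod_i c i) (J (fun=> 0) (fun=> 1)) (fun=> 0%N))); last exact: e.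
rewrite /upair; apply: f_equal; apply/funext => y.
rewrite /tens mul1r -big_split /=; apply: eq_bigr => i _.
by rewrite /gjet /= !hornerC mul1r.
Qed.

(** The q_i are replaced by c_i one slot at a time. Each difference is one pairing with q_j - c_j in
    slot j, bounded by Q_j - b_j times the bounds of the other slots, and these products
    telescope. *)
Lemma telescoped_slots (r M : R) (q : 'I_d -> {poly C}) (c : 'I_d -> C) (b Q : 'I_d -> R) (n : nat) :
  0 < r <= 1 -> (0 < n)%N -> (forall i, (size (q i) <= n)%N) -> 0 <= M ->
  (forall i, normc (c i) <= b i) -> (forall i, wnorm n r (q i) <= Q i) ->
  (forall i, wnorm n r (q i - (c i)%:P) <= Q i - b i) ->
  (forall t, (forall i, normc (t i) <= r) -> normc (upair (J t (fun=> 1))) <= M) ->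
  normc (upair (J (fun=> 0) q) - \prod_i c i * upair (J (fun=> 0) (fun=> 1))) <=
    (\prod_i Q i - \prod_i b i) * M.
Proof.
move=> hr n0 sq M0 cb qQ qcb hM; have /andP[r0 r1] := hr.
pose D k := fun i : 'I_d => if (i < k)%N then (c i)%:P else q i.
pose DB k := fun i : 'I_d => if (i < k)%N then b i else Q i.
have sD k i : (size (D k i) <= n)%N.
  by rewrite /D; case: ifP => _ //; rewrite (leq_trans (size_polyC_leq1 _)).
suff H k : (k <= d)%N -> normc (upair (J (fun=> 0) q) - upair (J (fun=> 0) (D k))) <=
    (\prod_i Q i - \prod_i DB k i) * M.
  rewrite -upair_const (_ : \prod_i b i = \prod_i DB d i); last first.
    by apply: eq_bigr => i _; rewrite /DB ltn_ord.
  rewrite (_ : (fun i => gj i 0 (c i)%:P) = J (fun=> 0) (D d)); first exact: H.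
  by apply/funext => i; rewrite /D ltn_ord.
elim: k => [|k IH] kd.
  rewrite (_ : D 0%N = q); last by apply/funext => i; rewrite /D ltn0.
  by rewrite subrr normc0 mulr_ge0// subr_ge0.
pose j := Ordinal kd.
have ltk i : i != j -> (i < k.+1)%N = (i < k)%N.
  by move=> /negbTE ij; rewrite ltnS leq_eqVlt -[i == k :> nat]/(i == j) ij.
have eD : J (fun=> 0) (D k) = upd (J (fun=> 0) (D k.+1)) j (gj j 0 (q j)).
  apply/funext => i; rewrite /upd /D; case: eqP => [->|/eqP ij]; first by rewrite ltnn.
  by rewrite ltk.
have eD' : J (fun=> 0) (D k.+1) = upd (J (fun=> 0) (D k.+1)) j (gj j 0 (c j)%:P).
  by apply/funext => i; rewrite /upd /D; case: eqP => [->|//]; rewrite ltnSn.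
pose D' := fun i => if i == j then q j - (c j)%:P else D k.+1 i.
have diff : upair (J (fun=> 0) (D k)) - upair (J (fun=> 0) (D k.+1)) = upair (J (fun=> 0) D').
  rewrite eD [in X in _ - X]eD' -mulN1r -(@upair_add (3 * 3))//.
  congr upair; apply/funext => i; rewrite /upd /D'; case: eqP => [->|//].
  apply/funext => l; apply/funext => s.
  by rewrite -gjetD scaleN1r.
have nd : normc (upair (J (fun=> 0) D')) <= \prod_i wnorm n r (D' i) * M.
  apply: all_slots_cauchy => // i; rewrite /D'; case: eqP => _ //.
  rewrite (leq_trans (size_polyD _ _))// geq_max sq size_polyN.
  by rewrite (leq_trans (size_polyC_leq1 _)).
have -> : upair (J (fun=> 0) q) - upair (J (fun=> 0) (D k.+1)) =
    upair (J (fun=> 0) q) - upair (J (fun=> 0) (D k)) + upair (J (fun=> 0) D').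
  by rewrite -diff addrA subrK.
apply: le_trans (normcD _ _) _.
apply: le_trans (lerD (IH (ltnW kd)) nd) _.
rewrite -mulrDl; apply: ler_wpM2r => //.
have -> : \prod_i DB k i = Q j * \prod_(i < d | i != j) DB k.+1 i.
  rewrite (bigD1 j)//= {1}/DB ltnn; congr (_ * _); apply: eq_bigr => i ij.
  by rewrite /DB ltk.
have -> : \prod_i DB k.+1 i = b j * \prod_(i < d | i != j) DB k.+1 i.
  by rewrite (bigD1 j)//= {1}/DB ltnSn.
rewrite (bigD1 (P := predT) (F := fun i => wnorm n r (D' i)) j)//= {1}/D' eqxx.
have h : \prod_(i < d | i != j) wnorm n r (D' i) <= \prod_(i < d | i != j) DB k.+1 i.
  apply: ler_prod => i ij; rewrite wnorm_ge0//= /D' (negbTE ij) /D /DB.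
  by case: ifP => _ //; apply: le_trans (wnormC_le _ _ _) _.
have h2 := ler_pM (wnorm_ge0 n r0 (q j - (c j)%:P)) _ (qcb j) h.
have {}h2 := h2 (prodr_ge0 _ (fun i _ => wnorm_ge0 n r0 (D' i))).
by move: h2; rewrite mulrBl; lra.
Qed.

End Slots.

(** * Wave packets and the transposed operator *)

Section WavePackets.
Context {R : realType} {d : nat}.
Local Notation E := 'rV[R]_d.
Local Notation C := R[i].
Implicit Types (x xi : E).

Definition wpjet x xi (t : 'I_d -> C) (q : 'I_d -> {poly C}) : 'I_d -> nat -> R -> C :=
  fun i => gjet (x 0 i) (xi 0 i) (t i) (q i).

Lemma enorm_sqr x : enorm x ^+ 2 = \sum_(i < d) x 0 i ^+ 2.
Proof.
by rewrite /enorm sqr_sqrtr /dot; [|apply: sumr_ge0 => i _; rewrite -expr2 sqr_ge0].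
Qed.

Lemma wave_packetE x xi :
  wave_packet x xi = tens 1 (wpjet x xi (fun=> 0) (fun=> 1)) (fun=> 0%N).
Proof.
apply/funext => y; rewrite /tens mul1r /wave_packet.
have -> : (expR (- (enorm (y - x) ^+ 2 / 2)))%:C * (cos (dot y xi) -i* sin (dot y xi)) =
    cexp (\sum_(i < d) (- ((y 0 i - x 0 i) ^+ 2 / 2))) (\sum_(i < d) (- (y 0 i * xi 0 i))).
  rewrite /cexp !sumrN cosN sinN enorm_sqr mulr_suml; congr ((expR (- _))%:C * _).
  by apply: eq_bigr => i _; rewrite !mxE.
rewrite cexp_sum; apply: eq_bigr => i _.
by rewrite /wpjet /gjet /= hornerC mul1r /gexp /= !mul0r addr0 sub0r.
Qed.

(** Completing the square: -(y - x)^2/2 + Re t (y - x) = -(y - x - Re t)^2/2 + (Re t)^2/2, while Im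
    t shifts the frequency and leaves a phase. *)
Lemma tens_wpjetE x xi (t : 'I_d -> C) : exists2 k : C,
  normc k = expR (\sum_(i < d) (complex.Re (t i) ^+ 2 / 2)) &
  tens 1 (wpjet x xi t (fun=> 1)) (fun=> 0%N) =
  tens k (wpjet (x + \row_i complex.Re (t i)) (xi - \row_i complex.Im (t i))
     (fun=> 0) (fun=> 1)) (fun=> 0%N).
Proof.
exists (cexp (\sum_(i < d) (complex.Re (t i) ^+ 2 / 2)) (\sum_(i < d) (- (complex.Im (t i) * x 0 i)))).
  exact: normc_cexp.
apply/funext => y; rewrite /tens cexp_sum mul1r -big_split; apply: eq_bigr => i _ /=.
rewrite /wpjet /gjet /= !hornerC !mul1r /gexp -cexpD !mxE /=.
by congr cexp; field.
Qed.

Variables (theta : R) (u : (E -> C) -> C).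
Hypotheses (htheta : 2^-1 <= theta) (hu : GS_dual theta u).

Let theta_gt0 : 0 < theta. Proof. by apply: lt_le_trans htheta; rewrite invr_gt0. Qed.

(** The d slots together give exp (2 d theta (rho/B)^(1/theta)), and [B] is chosen with B^(1/theta)
    >= 2 d theta/delta. [K] comes from continuity on the step [3 * B], hence depends on [delta]. *)
Lemma wave_packet_growth (delta : R) : 0 < delta -> exists2 K : R, 0 < K &
  forall x xi (rho : R), 0 <= rho -> (forall i, `|x 0 i| <= rho) -> (forall i, `|xi 0 i| <= rho) ->
  normc (u (wave_packet x xi)) <= K * expR (delta * rho `^ theta^-1).
Proof.
move=> delta0; pose z := 2 * d%:R * theta / delta.
have z0 : 0 <= z by rewrite divr_ge0 ?mulr_ge0// ltW.
pose B := 3 + z `^ theta.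
have B3 : 3 <= B by rewrite lerDl powR_ge0.
have B0 : 0 < B by exact: lt_le_trans B3.
have A0 : 0 < 3 * B by rewrite mulr_gt0.
have [K K0 hK] := GS_dual_tens_le A0 hu.
exists (K * (2 * expR 1) ^+ d); first by rewrite mulr_gt0 ?exprn_gt0 ?mulr_gt0 ?expR_gt0.
move=> x xi rho rho0 hx hxi; rewrite wave_packetE.
have := hK (wpjet x xi (fun=> 0) (fun=> 1)) (fun=> 2 * expR 1 * growth theta rho B ^+ 2).
have n0 i : normc (0 - 0 +i* xi 0 i) <= rho by rewrite sub0r normcN normc_Ni.
move=> /(_ (fun i => gjet_jet _ _ _ _) _ _)h; apply: le_trans (h _ _) _.
- move=> i; have := gjet_bounded htheta B3 (hx i) (n0 i) _ 0.
  by rewrite /= normr0 sqrtr1 mulr1 mulr1; apply.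
- by move=> i; rewrite mulr_gt0 ?exprn_gt0 ?mulr_gt0 ?expR_gt0.
rewrite prodr_const card_ord exprMn -!mulrA; apply: ler_wpM2l; first exact: ltW.
apply: ler_wpM2l; first by rewrite exprn_ge0// mulr_ge0// expR_ge0.
rewrite -exprM /growth -expRM_natl ler_expR natrM mulrA.
have iB0 : 0 <= B^-1 by rewrite invr_ge0 ltW.
have e : (rho / B) `^ theta^-1 = rho `^ theta^-1 / B `^ theta^-1.
  rewrite powRM// -[in RHS]powRN -[B^-1](powR_inv1 (ltW B0)) -powRrM mulN1r//.
have zB : z <= B `^ theta^-1.
  have -> : z = (z `^ theta) `^ theta^-1 by rewrite -powRrM mulfV ?gt_eqF// powRr1.
  by apply: ge0_ler_powR; rewrite ?invr_ge0 ?nnegrE ?powR_ge0 ?lerDr// ltW.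
have zd : 2 * d%:R * theta = z * delta by rewrite /z divfK// gt_eqF.
have Bp : 0 < B `^ theta^-1 by exact: powR_gt0.
rewrite e; set p := rho `^ _; have p0 : 0 <= p by exact: powR_ge0.
rewrite (_ : _ * _ = z * delta * p / B `^ theta^-1); last by rewrite -zd; ring.
rewrite ler_pdivrMr// -mulrA [leRHS]mulrC; apply: ler_wpM2r => //.
by rewrite mulr_ge0// ltW.
Qed.

(** [tens_wpjetE] moves the base point by Re t and the frequency by -Im t; as r <= 1, the modulus of
    its factor is at most e^d. *)
Lemma upair_wpjet_le x xi (r S : R) (t : 'I_d -> C) : 0 <= r <= 1 ->
  (forall i, normc (t i) <= r) ->
  (forall x' xi', (forall i, `|x' 0 i - x 0 i| <= r) -> (forall i, `|xi' 0 i - xi 0 i| <= r) ->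
     normc (u (wave_packet x' xi')) <= S) ->
  normc (upair u (wpjet x xi t (fun=> 1))) <= expR d%:R * S.
Proof.
move=> /andP[r0 r1] ht hS.
have [k nk e] := tens_wpjetE x xi t.
have t0 : `|complex.Re (0 : C)| <= 1 by rewrite /= normr0.
rewrite /upair e (@upair_scale _ _ theta u hu k _ (3 * 3)); last first.
- by move=> i; exact: gjet_good.
- by rewrite mulr_gt0.
rewrite normcM nk /upair -wave_packetE; apply: ler_pM; rewrite ?normc_ge0 ?expR_ge0//.
  rewrite ler_expR -[X in _ <= X%:R]card_ord -sumr_const; apply: ler_sum => i _.
  have := le_trans (ler_Re_normc (t i)) (le_trans (ht i) r1).
  by rewrite ler_norml => /andP[]; nra.
apply: hS => i; rewrite !mxE.
  by rewrite addrAC subrr add0r; apply: le_trans (ler_Re_normc _) (ht i).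
by rewrite addrAC subrr add0r normrN; apply: le_trans (ler_Im_normc _) (ht i).
Qed.

Section operator.
Variables (m : nat) (c : ('I_d -> nat) -> ('I_d -> nat) -> C).
Local Notation bmi := {ffun 'I_d -> 'I_m.+1}.

(** The polynomials in y - x that the operator of [Dop_monomial_wave_packet] produces:
    multiplication by y is X + x, a derivative is [hop] at frequency -i xi. *)
Definition transq x xi (a b : 'I_d -> nat) : 'I_d -> {poly C} :=
  fun i => iter (a i) (hop (0 - 0 +i* xi 0 i)) (('X + (x 0 i)%:C%:P) ^+ b i).

Lemma monomial_wave_packet x xi b :
  (fun y => (monomial b y)%:C * wave_packet x xi y) =
  tens 1 (wpjet x xi (fun=> 0) (transq x xi (fun=> 0%N) b)) (fun=> 0%N).
Proof.
apply/funext => y; rewrite wave_packetE /tens !mul1r /monomial rmorph_prod -big_split.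
apply: eq_bigr => i _; rewrite /= /wpjet /gjet /= hornerC mul1r; congr (_ * _).
by rewrite horner_exp !hornerE rmorphXn rmorphB /= subrK.
Qed.

Lemma Dop_monomial_wave_packet x xi a b :
  Dop a (fun y => (monomial b y)%:C * wave_packet x xi y) =
  tens ((0 -i* 1) ^+ mdeg a) (wpjet x xi (fun=> 0) (transq x xi a b)) (fun=> 0%N).
Proof.
rewrite monomial_wave_packet; apply/funext => y; rewrite /Dop mpartial_tens; last by move=> i; exact: gjet_jet.
by rewrite -[in RHS](mulr1 (_ ^+ _)) tensZ; congr (_ * _).
Qed.

Lemma diffop_wave_packet x xi : diffop m c u (wave_packet x xi) =
  \sum_(ab : bmi * bmi | (mdeg (mi ab.1) + mdeg (mi ab.2) <= m)%N)
    c (mi ab.1) (mi ab.2) * ((-1 * (0 -i* 1)) ^+ mdeg (mi ab.1) *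
      upair u (wpjet x xi (fun=> 0) (transq x xi (mi ab.1) (mi ab.2)))).
Proof.
apply: eq_bigr => -[a b] _ /=; congr (_ * _).
rewrite /dual_monomial /dual_Dop Dop_monomial_wave_packet exprMn -mulrA; congr (_ * _).
have t0 : `|complex.Re (0 : C)| <= 1 by rewrite /= normr0.
apply: (@upair_scale _ _ theta u hu _ _ (3 * 3)); first by rewrite mulr_gt0.
by move=> i; exact: gjet_good.
Qed.

(** A derivative contributes -i xi, and transposing D contributes (-1)(-i) = i; their product is
    xi. *)
Lemma symbol_factor x xi (a b : 'I_d -> nat) :
  (-1 * (0 -i* 1)) ^+ mdeg a * \prod_i ((0 - 0 +i* xi 0 i) ^+ a i * (x 0 i)%:C ^+ b i) =
  (monomial b x)%:C * (monomial a xi)%:C :> C.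
Proof.
rewrite /mdeg /monomial -prodrXr !rmorph_prod -!big_split; apply: eq_bigr => i _ /=.
rewrite mulrA -exprMn mulrC !rmorphXn; congr (_ * _ ^+ _).
by apply/eqP; rewrite eq_complex /=; apply/andP; split; apply/eqP; ring.
Qed.

Section error.
Variables (x xi : E) (r rho eta M : R).
Hypotheses (r01 : 0 < r <= 1) (hx : forall i, `|x 0 i| <= rho) (hxi : forall i, `|xi 0 i| <= rho)
  (rho1 : 1 <= rho) (eta0 : 0 <= eta) (hre : r + m.+1%:R / r <= rho * eta)
  (rhoeta : 1 <= rho * eta)
  (hM : forall t : 'I_d -> C, (forall i, normc (t i) <= r) ->
      normc (upair u (wpjet x xi t (fun=> 1))) <= M).

Let M0 : 0 <= M.
Proof.
apply: le_trans (hM (t := fun=> 0) _); first exact: normc_ge0.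
by move=> i; rewrite normc0 ltW//; case/andP: r01.
Qed.

Lemma term_error (a b : 'I_d -> nat) : (mdeg a + mdeg b <= m)%N ->
  normc ((-1 * (0 -i* 1)) ^+ mdeg a * upair u (wpjet x xi (fun=> 0) (transq x xi a b)) -
    (monomial b x)%:C * (monomial a xi)%:C * u (wave_packet x xi)) <=
  ((rho * (1 + eta)) ^+ (mdeg a + mdeg b) - rho ^+ (mdeg a + mdeg b)) * M.
Proof.
move=> abm; have /andP[r0 r1] := r01.
have rho0 : 0 <= rho by apply: le_trans rho1.
have ntau i : normc (0 - 0 +i* xi 0 i) <= rho by rewrite sub0r normcN normc_Ni.
have abi i : (a i + b i < m.+1)%N.
  rewrite ltnS; apply: leq_trans abm; apply: leq_add.
    by rewrite /mdeg (bigD1 i)//= leq_addr.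
  by rewrite /mdeg (bigD1 i)//= leq_addr.
have near i := near_const_symbol r0 rho0 eta0 hre (hx i) (ntau i) (abi i).
rewrite -symbol_factor -mulrA -mulrBr normcM normcX.
have -> : normc (-1 * (0 -i* 1) : C) = 1.
  by rewrite mulN1r normcN -[0 -i* 1]/(0 +i* (-1)) normc_Ni normrN normr1.
rewrite expr1n mul1r.
have := @telescoped_slots R d theta u htheta hu x xi r M (transq x xi a b)
  (fun i => (0 - 0 +i* xi 0 i) ^+ a i * (x 0 i)%:C ^+ b i) (fun i => rho ^+ (a i + b i))
  (fun i => (rho * (1 + eta)) ^+ (a i + b i)) m.+1 r01 isT.
rewrite !prodrXr !big_split /= -/(mdeg a) -/(mdeg b) wave_packetE.
apply => //.
- by move=> i; have [sp _ _ _] := near i; apply: leq_trans sp _.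
- by move=> i; have [] := near i.
- by move=> i; have [] := near i.
- by move=> i; have [] := near i.
Qed.

(** Top-order terms differ from the symbol by rho^m ((1 + eta)^m - 1). Lower-order terms are bounded
    whole: [rhoeta] trades a missing power of rho for a factor eta. The exponent m + 1 covers both,
    as (1 + eta)^(m+1) - 1 >= eta (1 + eta)^m. *)
Lemma symbol_error :
  normc (diffop m c u (wave_packet x xi) - psymbol m c x xi * u (wave_packet x xi)) <=
  (\sum_(ab : bmi * bmi) normc (c (mi ab.1) (mi ab.2))) *
    (rho ^+ m * ((1 + eta) ^+ m.+1 - 1)) * M.
Proof.
have rho0 : 0 <= rho by apply: le_trans rho1.
set F := u (wave_packet x xi).
have FM : normc F <= M.
  rewrite /F wave_packetE; apply: hM => i.
  by rewrite normc0 ltW//; case/andP: r01.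
rewrite diffop_wave_packet /psymbol.
rewrite [X in _ - X * _](eq_bigl (fun ab : bmi * bmi => (mdeg (mi ab.1) + mdeg (mi ab.2) <= m)%N &&
   (mdeg (mi ab.1) + mdeg (mi ab.2) == m)%N)) => [|ab]; last first.
  by case: eqP => [->|]; rewrite ?leqnn ?andbF.
rewrite big_mkcondr mulr_suml -sumrB; apply: le_trans (normc_sum _ _ _) _.
rewrite big_mkcond /= -mulrA mulr_suml; apply: ler_sum => -[a b] _ /=.
have e1 : 1 <= (1 + eta) ^+ m by rewrite exprn_ege1// lerDl.
have W0 : 0 <= rho ^+ m * ((1 + eta) ^+ m.+1 - 1) * M.
  rewrite !mulr_ge0 ?exprn_ge0// subr_ge0 exprn_ege1// lerDl//.
case: ifP => [abm|_]; last by rewrite mulr_ge0 ?normc_ge0.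
have te := term_error abm; rewrite -/F in te; case: eqP => [abe|/eqP abn].
  rewrite -!mulrA -mulrBr normcM; apply: ler_wpM2l; first exact: normc_ge0.
  rewrite !mulrA; apply: le_trans te _; rewrite abe; apply: ler_wpM2r => //.
  rewrite exprMn -[X in _ - X]mulr1 -mulrBr; apply: ler_wpM2l; first by rewrite exprn_ge0.
  by rewrite lerD2r exprS ler_peMl// ?lerDl// (le_trans ler01).
rewrite mul0r subr0 normcM; apply: ler_wpM2l; first exact: normc_ge0.
set T := _ * upair _ _ in te *; set s := (_ + _)%N in te.
have sm : (s < m)%N by rewrite ltn_neqAle abn.
have nT : normc T <= (rho * (1 + eta)) ^+ s * M.
  rewrite -[T](subrK ((monomial (mi b) x)%:C * (monomial (mi a) xi)%:C * F)).
  apply: le_trans (normcD _ _) _; rewrite -[X in _ <= X * M](subrK (rho ^+ s)) mulrDl.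
  apply: lerD => //; rewrite normcM; apply: ler_pM; rewrite ?normc_ge0//.
  rewrite normcM !normc_real /monomial !normr_prod /s exprD mulrC /mdeg -!prodrXr.
  apply: ler_pM; rewrite ?prodr_ge0//.
    by apply: ler_prod => i _; rewrite normr_ge0 normrX lerXn2r ?nnegrE.
  by apply: ler_prod => i _; rewrite normr_ge0 normrX lerXn2r ?nnegrE.
apply: le_trans nT _; apply: ler_wpM2r => //; rewrite exprMn.
apply: (@le_trans _ _ (rho ^+ m * (eta * (1 + eta) ^+ m))).
  apply: (@le_trans _ _ (rho ^+ s * (1 + eta) ^+ m)).
    by apply: ler_wpM2l; [rewrite exprn_ge0|apply: ler_weXn2l; rewrite ?lerDl// ltnW].
  rewrite mulrA; apply: ler_wpM2r; first by rewrite (le_trans ler01).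
  rewrite -(subnKC sm) exprD exprSr -!mulrA; apply: ler_peMr; first by rewrite exprn_ge0.
  rewrite mulrCA; apply: mulr_ege1 => //; exact: exprn_ege1.
apply: ler_wpM2l; first by rewrite exprn_ge0.
by rewrite exprS mulrDl mul1r addrAC lerDr subr_ge0.
Qed.

End error.
End operator.
End WavePackets.

(** * Decay of the transform on an elliptic cone *)

Section EllipticDecay.
Context {R : realType} {d m : nat}.
Local Notation E := 'rV[R]_d.
Local Notation C := R[i].
Variables (theta : R) (u : (E -> C) -> C) (c : ('I_d -> nat) -> ('I_d -> nat) -> C).
Hypotheses (htheta : 2^-1 <= theta) (hu : GS_dual theta u).

Implicit Types (x xi : E).

Local Notation F x xi := (normc (u (wave_packet x xi))).

Lemma exprn1D_le (eta : R) n : 0 <= eta <= 1 -> (1 + eta) ^+ n <= 1 + eta * (2 ^+ n - 1).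
Proof.
move=> /andP[e0 e1]; elim: n => [|n IH]; first by rewrite !expr0 subrr mulr0 addr0.
rewrite exprS; apply: le_trans (ler_wpM2l _ IH) _; first by rewrite addr_ge0.
have T1 : 0 <= 2 ^+ n - 1 :> R by rewrite subr_ge0 exprn_ege1// ler1n.
have e1' : 0 <= 1 - eta by rewrite subr_ge0.
by have := mulr_ge0 (mulr_ge0 e0 T1) e1'; rewrite exprS; lra.
Qed.

Variables (x0 xi0 : E) (kappa c0 b A e1 : R).
Hypotheses (kappa0 : 0 < kappa) (c00 : 0 < c0) (b1 : 1 <= b) (A0 : 0 < A) (e10 : 0 < e1).

(** A cube about lam (x0, xi0); with [s] proportional to [lam] these cubes sweep out a conic
    neighbourhood. *)
Definition cone_slice (lam : R) (s : R) (x xi : E) : Prop :=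
  (forall i, `|x 0 i - lam * x0 0 i| < s) /\ (forall i, `|xi 0 i - lam * xi0 0 i| < s).

Hypothesis slice_bound : forall lam x xi, 0 < lam -> cone_slice lam (kappa * lam) x xi ->
  (forall i, `|x 0 i| <= b * lam) /\ (forall i, `|xi 0 i| <= b * lam).
Hypothesis slice_decay : forall lam x xi, 0 < lam -> cone_slice lam (kappa * lam) x xi ->
  normc (diffop m c u (wave_packet x xi)) <= A * expR (- (e1 * lam `^ theta^-1)).
Hypothesis slice_elliptic : forall lam x xi, 0 < lam -> cone_slice lam (kappa * lam) x xi ->
  c0 * lam ^+ m <= normc (psymbol m c x xi).

Let b0 : 0 < b. Proof. exact: lt_le_trans b1. Qed.
Let theta_gt0 : 0 < theta. Proof. by apply: lt_le_trans htheta; rewrite invr_gt0. Qed.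

Let Cs : R := \sum_(ab : {ffun 'I_d -> 'I_m.+1} * {ffun 'I_d -> 'I_m.+1})
  normc (c (mi ab.1) (mi ab.2)).
Let Z : R := Cs * b ^+ m * expR d%:R * 2 ^+ m.+1.
(** With r = K/lam: [eta] gives Z eta <= c0/2, and [K] makes (m + 1)/r equal to b lam eta/2. The
    summands of [lam0] ensure in turn lam >= 1, r <= 1, r <= b lam eta/2 and b lam eta >= 1. *)
Let eta : R := c0 / (c0 + 2 * Z + 1).
Let K : R := 2 * m.+1%:R / (b * eta).
Let lam0 : R := 1 + K + 2 * K / (b * eta) + 1 / (b * eta).

Let Cs0 : 0 <= Cs. Proof. by apply: sumr_ge0 => ab _; exact: normc_ge0. Qed.
Let Z0 : 0 <= Z. Proof. by rewrite !mulr_ge0 ?expR_ge0 ?exprn_ge0// ltW. Qed.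
Let den0 : 0 < c0 + 2 * Z + 1. Proof. by have := Z0; have := c00; lra. Qed.
Let eta0 : 0 < eta. Proof. exact: divr_gt0. Qed.
Let eta1 : eta <= 1. Proof. by rewrite ler_pdivrMr// mul1r; have := Z0; lra. Qed.
Let beta0 : 0 < b * eta. Proof. exact: mulr_gt0. Qed.
Let K0 : 0 < K. Proof. by rewrite divr_gt0// mulr_gt0. Qed.

Lemma slice_step (lam S : R) x xi : lam0 <= lam -> cone_slice lam (kappa * lam) x xi ->
  0 <= S ->
  (forall x' xi', (forall i, `|x' 0 i - x 0 i| <= K / lam) ->
     (forall i, `|xi' 0 i - xi 0 i| <= K / lam) -> F x' xi' <= S) ->
  F x xi <= A / c0 * expR (- (e1 * lam `^ theta^-1)) + S / 2.
Proof.
move=> hl hs S0 hS.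
have q1 : 0 < 2 * K / (b * eta) by rewrite divr_gt0// mulr_gt0.
have q2 : 0 < 1 / (b * eta) by rewrite divr_gt0.
have l1 : 1 <= lam by move: hl; rewrite /lam0; have := K0; lra.
have lK : K <= lam by move: hl; rewrite /lam0; lra.
have l2 : 2 * K / (b * eta) <= lam by move: hl; rewrite /lam0; have := K0; lra.
have l3 : 1 / (b * eta) <= lam by move: hl; rewrite /lam0; have := K0; lra.
have l0 : 0 < lam by exact: lt_le_trans l1.
have r0 : 0 < K / lam by exact: divr_gt0.
have r1 : K / lam <= 1 by rewrite ler_pdivrMr// mul1r.
have [hx hxi] := slice_bound l0 hs.
have rho1 : 1 <= b * lam by exact: mulr_ege1.
have re1 : 1 <= b * lam * eta by move: l3; rewrite ler_pdivrMr// mulrC mulrAC.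
have hre : K / lam + m.+1%:R / (K / lam) <= b * lam * eta.
  have h1 : K / lam <= b * lam * eta / 2.
    rewrite ler_pdivrMr//; move: l2; rewrite ler_pdivrMr// => l2.
    have : 1 * (lam * (b * eta)) <= lam * (lam * (b * eta)).
      by apply: ler_wpM2r => //; rewrite mulr_ge0// ltW.
    by move: l2; lra.
  have h2 : m.+1%:R / (K / lam) = b * lam * eta / 2.
    by rewrite /K; field; rewrite !gt_eqF// -natr1 ltr_wpDl.
  by rewrite h2; move: h1; lra.
have hM t : (forall i, normc (t i) <= K / lam) -> normc (upair u (wpjet x xi t (fun=> 1))) <= expR d%:R * S.
  by move=> ht; apply: (upair_wpjet_le htheta hu _ ht hS); rewrite ltW.
have r01 : 0 < K / lam <= 1 by rewrite r0.
have err := symbol_error htheta hu c r01 hx hxi rho1 (ltW eta0) hre re1 hM.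
have ell := slice_elliptic l0 hs.
have dec := slice_decay l0 hs.
have lm1 : 1 <= lam ^+ m by exact: exprn_ege1.
have lm0 : 0 < lam ^+ m by exact: lt_le_trans lm1.
(* The error uses up at most half of the elliptic lower bound, so division by that bound leaves
   S/2. *)
have errS : Cs * ((b * lam) ^+ m * ((1 + eta) ^+ m.+1 - 1)) * (expR d%:R * S) <= c0 * lam ^+ m * (S / 2).
  have e01 : 0 <= eta <= 1 by rewrite ltW.
  have h1 : (1 + eta) ^+ m.+1 - 1 <= eta * 2 ^+ m.+1.
    by have := exprn1D_le m.+1 e01; have := eta0; lra.
  apply: (@le_trans _ _ (Z * eta * (lam ^+ m * S))).
    rewrite exprMn [leLHS](_ : _ = (Cs * b ^+ m * expR d%:R * (lam ^+ m * S)) * ((1 + eta) ^+ m.+1 - 1)); last by ring.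
    rewrite [leRHS](_ : _ = (Cs * b ^+ m * expR d%:R * (lam ^+ m * S)) * (eta * 2 ^+ m.+1)); last by rewrite /Z; ring.
    by apply: ler_wpM2l => //; rewrite !mulr_ge0 ?expR_ge0 ?exprn_ge0// ltW.
  rewrite [leRHS](_ : _ = c0 / 2 * (lam ^+ m * S)); last by ring.
  apply: ler_wpM2r; first by rewrite mulr_ge0// ltW.
  rewrite /eta mulrA ler_pdivrMr//.
  have : 0 <= c0 * (c0 + 1) by rewrite mulr_ge0 ?addr_ge0// ltW.
  by move: Z0 c00; generalize Z => z z0 c0p h; nra.
have tri : normc (psymbol m c x xi) * F x xi <=
    normc (diffop m c u (wave_packet x xi)) + c0 * lam ^+ m * (S / 2).
  rewrite -normcM -[psymbol m c x xi * _](subKr (diffop m c u (wave_packet x xi))).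
  apply: le_trans (normcD _ _) _; rewrite normcN; apply: lerD => //.
  exact: le_trans err errS.
have F0 : 0 <= F x xi by exact: normc_ge0.
have : c0 * lam ^+ m * F x xi <= c0 * lam ^+ m * (A / c0 * expR (- (e1 * lam `^ theta^-1)) + S / 2).
  apply: (@le_trans _ _ (normc (psymbol m c x xi) * F x xi)); first exact: ler_wpM2r.
  apply: le_trans tri _; rewrite [leRHS]mulrDr; apply: lerD => //; apply: le_trans dec _.
  rewrite mulrCA mulrA; apply: ler_wpM2r; first exact: expR_ge0.
  by rewrite [leRHS](_ : _ = A * lam ^+ m) ?ler_peMr ?(ltW A0)//; field; rewrite gt_eqF.
by rewrite ler_pM2l// mulr_gt0.
Qed.

(** Each step narrows the slice by the radius [K / lam] of the box; the source terms form a
    geometric series with sum at most twice the first. *)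
Lemma slice_iteration (lam S0 : R) n : lam0 <= lam -> 0 <= S0 ->
  (forall x xi, cone_slice lam (kappa * lam) x xi -> F x xi <= S0) ->
  forall x xi, cone_slice lam (kappa * lam - n%:R * (K / lam)) x xi ->
  F x xi <= 2 * (A / c0 * expR (- (e1 * lam `^ theta^-1))) + S0 / 2 ^+ n.
Proof.
move=> hl S00 hS.
have q1 : 0 < 2 * K / (b * eta) by rewrite divr_gt0// mulr_gt0.
have q2 : 0 < 1 / (b * eta) by rewrite divr_gt0.
have l0 : 0 < lam by move: hl; rewrite /lam0; have := K0; lra.
have r0 : 0 < K / lam by exact: divr_gt0.
set D := A / c0 * _; have D0 : 0 <= D by rewrite mulr_ge0 ?expR_ge0// divr_ge0// ltW.
elim: n => [|n IH] x xi.
  rewrite mul0r subr0 expr0 divr1 => /hS h; apply: le_trans h _.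
  by rewrite lerDr mulr_ge0.
rewrite -natr1 => -[hx hxi].
have hsl : cone_slice lam (kappa * lam) x xi.
  split=> i; [apply: lt_le_trans (hx i) _|apply: lt_le_trans (hxi i) _];
  by rewrite lerBlDr lerDl mulr_ge0// ltW.
have S0n : 0 <= S0 / 2 ^+ n by apply: divr_ge0 => //; exact: exprn_ge0.
have S'0 : 0 <= 2 * D + S0 / 2 ^+ n by apply: addr_ge0 => //; exact: mulr_ge0.
apply: le_trans (slice_step hl hsl S'0 _) _; last first.
  rewrite -/D exprS invfM le_eqVlt; apply/orP; left; apply/eqP; field.
  by rewrite expf_neq0.
move=> x' xi' hx' hxi'; apply: IH; split => i.
  have := hx i; have := hx' i; have := ler_distD (x 0 i) (x' 0 i) (lam * x0 0 i); lra.
have := hxi i; have := hxi' i; have := ler_distD (xi 0 i) (xi' 0 i) (lam * xi0 0 i); lra.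
Qed.

(** e^(1/2) <= 2, because e^(-1/2) >= 1 - 1/2. *)
Lemma expRNhalf_ge (n : nat) : (2 ^+ n)^-1 <= expR (- (n%:R / 2)) :> R.
Proof.
rewrite expRN lef_pV2 ?posrE ?expR_gt0 ?exprn_gt0// expRM_natl.
apply: lerXn2r; rewrite ?nnegrE ?expR_ge0//.
have := expR_ge1Dx (- 2^-1 : R); rewrite expRN => h.
by rewrite -lef_pV2 ?posrE ?expR_gt0//; lra.
Qed.

Lemma slice_wave_packet_decay : exists C0 e2 : R, [/\ 0 < C0, 0 < e2 &
  forall lam x xi, 0 < lam -> cone_slice lam (kappa * lam / 2) x xi ->
  F x xi <= C0 * expR (- (e2 * lam `^ theta^-1))].
Proof.
set p := theta^-1.
have p0 : 0 < p by rewrite invr_gt0.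
have p2 : p <= 2 by rewrite /p -[leRHS]invrK lef_pV2 ?posrE// invr_gt0.
(* [g] is half the rate gained by iterating: y/2 = 2 g lam^2 for the number [y] of steps below.
   Growth at rate [g] thus leaves decay at rate [g]; dividing by b^p accounts for coordinates as
   large as b lam. *)
have [g [gE g0]] : exists g, g = kappa / (16 * K) /\ 0 < g.
  by exists (kappa / (16 * K)); rewrite divr_gt0// mulr_gt0.
have bp0 : 0 < b `^ p by exact: powR_gt0.
have [K1 K10 hK1] := wave_packet_growth htheta hu (divr_gt0 g0 bp0).
have q1 : 0 < 2 * K / (b * eta) by rewrite divr_gt0// mulr_gt0.
have q2 : 0 < 1 / (b * eta) by rewrite divr_gt0.
have lam00 : 0 < lam0 by rewrite /lam0; have := K0; lra.
pose e2 := Num.min e1 g.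
have e20 : 0 < e2 by rewrite lt_min e10.
have grow lam x xi : 0 < lam -> cone_slice lam (kappa * lam) x xi -> F x xi <= K1 * expR (g * lam `^ p).
  move=> l0 /(slice_bound l0)[hx hxi].
  have := hK1 x xi (b * lam) (ltW (mulr_gt0 b0 l0)) hx hxi; rewrite -/p.
  by rewrite powRM ?(ltW b0) ?(ltW l0)// mulrA divfK// gt_eqF.
(* The summands serve the source term, the iterated growth and the bounded range lam < lam0. *)
pose C0 := 2 * (A / c0) + 2 * K1 + K1 * expR (g * lam0 `^ p) * expR (e2 * lam0 `^ p).
have c1 : 0 < A / c0 by exact: divr_gt0.
have c3 : 0 < K1 * expR (g * lam0 `^ p) * expR (e2 * lam0 `^ p) by rewrite !mulr_gt0 ?expR_gt0.
exists C0, e2; split => //; first by rewrite /C0; lra.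
move=> lam x xi l0 hs.
have lp0 : 0 <= lam `^ p by exact: powR_ge0.
have [ll|ll] := ltP lam lam0.
  have hs' : cone_slice lam (kappa * lam) x xi.
    have kl : 0 < kappa * lam by exact: mulr_gt0.
    by have [hx hxi] := hs; split=> i; [move: (hx i)|move: (hxi i)]; lra.
  have lpl : lam `^ p <= lam0 `^ p.
    by apply: ge0_ler_powR; rewrite ?nnegrE; apply: ltW.
  apply: le_trans (grow _ _ _ l0 hs') _.
  apply: (@le_trans _ _ (K1 * expR (g * lam0 `^ p) * expR (e2 * lam0 `^ p) * expR (- (e2 * lam `^ p)))).
    rewrite -!mulrA; apply: ler_wpM2l; first exact: ltW.
    rewrite -!expRD ler_expR.
    have h1 : g * lam `^ p <= g * lam0 `^ p by apply: ler_wpM2l => //; exact: ltW.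
    have h2 : e2 * lam `^ p <= e2 * lam0 `^ p by apply: ler_wpM2l => //; exact: ltW.
    by lra.
  by apply: ler_wpM2r; [exact: expR_ge0|rewrite /C0; lra].
have l1 : 1 <= lam by apply: le_trans ll; rewrite /lam0; have := K0; lra.
(* As many steps as use up a quarter of the radius kappa lam, so that the half slice remains
   inside. *)
pose y := kappa * lam ^+ 2 / (4 * K).
have l2p : lam `^ p <= lam ^+ 2.
  by rewrite -[lam ^+ 2](powR_mulrn 2 (ltW l0)); exact: ler_powR.
have y0 : 0 <= y.
  by apply: divr_ge0; apply: mulr_ge0 => //; [exact: ltW|exact: exprn_ge0 (ltW l0)|exact: ltW].
have [n /andP[ny yn]] : exists n, n%:R <= y < n.+1%:R.
  by exists (Num.truncn y); exact: truncn_itv.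
have nr : n%:R * (K / lam) <= kappa * lam / 4.
  have -> : kappa * lam / 4 = y * (K / lam) by rewrite /y; field; rewrite !gt_eqF.
  by apply: ler_wpM2r => //; rewrite divr_ge0// ltW.
have hsn : cone_slice lam (kappa * lam - n%:R * (K / lam)) x xi.
  have kl : 0 < kappa * lam by exact: mulr_gt0.
  by have [hx hxi] := hs; split=> i; [move: (hx i)|move: (hxi i)]; lra.
have S0 : 0 <= K1 * expR (g * lam `^ p) by rewrite mulr_ge0 ?expR_ge0// ltW.
apply: le_trans (slice_iteration ll S0 (fun x xi => grow lam x xi l0) hsn) _.
(* Rounding [y] down loses less than one step, which the factor 2 makes up for. *)
have half : (2 ^+ n)^-1 <= 2 * expR (- (2 * g * lam `^ p)) :> R.
  have -> : (2 ^+ n)^-1 = 2 * (2 ^+ n.+1)^-1 :> R by rewrite exprS; field; rewrite expf_neq0.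
  apply: ler_wpM2l => //; apply: le_trans (expRNhalf_ge n.+1) _.
  rewrite ler_expR lerN2.
  apply: (@le_trans _ _ (y / 2)); last by rewrite ler_pM2r// ltW.
  have -> : y / 2 = 2 * g * lam ^+ 2 by rewrite /y gE; field; rewrite gt_eqF.
  by apply: ler_wpM2l => //; rewrite mulr_ge0// ltW.
have t1 : A / c0 * expR (- (e1 * lam `^ p)) <= A / c0 * expR (- (e2 * lam `^ p)).
  apply: ler_wpM2l; first exact: ltW.
  by rewrite ler_expR lerN2; apply: ler_wpM2r => //; rewrite ge_min lexx.
have t2 : K1 * expR (g * lam `^ p) / 2 ^+ n <= 2 * K1 * expR (- (e2 * lam `^ p)).
  apply: (@le_trans _ _ (K1 * expR (g * lam `^ p) * (2 * expR (- (2 * g * lam `^ p))))).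
    by apply: ler_wpM2l.
  rewrite [leLHS](_ : _ = 2 * K1 * (expR (g * lam `^ p) * expR (- (2 * g * lam `^ p)))); last by ring.
  apply: ler_wpM2l; first by rewrite mulr_ge0// ltW.
  rewrite -expRD ler_expR.
  have : e2 * lam `^ p <= g * lam `^ p by apply: ler_wpM2r => //; rewrite ge_min lexx orbT.
  by lra.
have ex0 := expR_ge0 (- (e2 * lam `^ p)).
have t1' : 2 * (A / c0 * expR (- (e1 * lam `^ p))) <= 2 * (A / c0) * expR (- (e2 * lam `^ p)).
  by rewrite -[leRHS]mulrA ler_pM2l.
apply: le_trans (lerD t1' t2) _; rewrite /C0 -mulrDl; apply: ler_wpM2r => //.
rewrite lerDl; exact: ltW c3.
Qed.

End EllipticDecay.

(** * Homogeneity and continuity of the principal symbol *)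

Section PrincipalSymbol.
Context {R : realType} {d : nat}.
Local Notation E := 'rV[R]_d.
Local Notation C := R[i].
Implicit Types (x xi : E).

Lemma monomialZ (a : 'I_d -> nat) (t : R) x : monomial a (t *: x) = t ^+ mdeg a * monomial a x.
Proof.
rewrite /monomial /mdeg -prodrXr -big_split; apply: eq_bigr => i _.
by rewrite mxE exprMn.
Qed.

Lemma psymbolZ m (c : ('I_d -> nat) -> ('I_d -> nat) -> C) (t : R) x xi :
  psymbol m c (t *: x) (t *: xi) = (t ^+ m)%:C * psymbol m c x xi.
Proof.
rewrite /psymbol mulr_sumr; apply: eq_bigr => -[a b] /= /eqP ab.
have -> : t ^+ m = t ^+ (mdeg (mi a) + mdeg (mi b)) by rewrite ab.
by rewrite !monomialZ exprD !rmorphM /=; ring.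
Qed.

Lemma monomial_continuous (a : 'I_d -> nat) : continuous (monomial a : E -> R).
Proof.
move=> x; rewrite /continuous_at /monomial; elim: (index_enum _) => [|i s IH].
  rewrite big_nil (_ : (fun _ => _) = cst 1).
    have h : continuous (cst 1 : E -> R) by exact: cst_continuous.
    exact: h.
  by apply/funext => y; rewrite big_nil.
rewrite big_cons (_ : (fun _ => _) =
  (fun y : E => y 0 i ^+ a i * \prod_(j <- s) y 0 j ^+ a j)); last first.
  by apply/funext => y; rewrite big_cons.
have ci : (fun y : E => y 0 i ^+ a i) @ x --> x 0 i ^+ a i.
  apply: (@continuous_comp _ _ _ (fun y : E => y 0 i) (fun z : R => z ^+ a i)).
    exact: coord_continuous.
  exact: exprn_continuous.
exact: cvgM ci IH.
Qed.

Let monomial2_continuous (k : R) (a b : 'I_d -> nat) :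
  continuous (fun w : E * E => k * monomial b w.1 * monomial a w.2).
Proof.
move=> w.
have c1 : (fun w : E * E => monomial b w.1) @ w --> monomial b w.1.
  apply: (@continuous_comp _ _ _ fst (monomial b)); first exact: cvg_fst.
  exact: monomial_continuous.
have c2 : (fun w : E * E => monomial a w.2) @ w --> monomial a w.2.
  apply: (@continuous_comp _ _ _ snd (monomial a)); first exact: cvg_snd.
  exact: monomial_continuous.
exact: cvgM (cvgM (cvg_cst k) c1) c2.
Qed.

Let sum_continuous (I : Type) (s : seq I) (P : pred I) (f : I -> E * E -> R) :
  (forall i, continuous (f i)) -> continuous (fun w => \sum_(i <- s | P i) f i w).
Proof.
move=> cf w; rewrite /continuous_at; elim: s => [|i s IH].
  rewrite big_nil (_ : (fun _ => _) = cst 0).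
    have h : continuous (cst 0 : E * E -> R) by exact: cst_continuous.
    exact: h.
  by apply/funext => y; rewrite big_nil.
rewrite big_cons; case: ifP => Pi.
  rewrite (_ : (fun _ => _) = (fun w => f i w + \sum_(j <- s | P j) f j w)); last first.
    by apply/funext => y; rewrite big_cons Pi.
  exact: cvgD (cf i w) IH.
rewrite (_ : (fun _ => _) = (fun w => \sum_(j <- s | P j) f j w))//.
by apply/funext => y; rewrite big_cons Pi.
Qed.

Lemma psymbol_continuous m (c : ('I_d -> nat) -> ('I_d -> nat) -> C) :
  continuous (fun w : E * E => complex.Re (psymbol m c w.1 w.2)) /\
  continuous (fun w : E * E => complex.Im (psymbol m c w.1 w.2)).
Proof.
split.
  rewrite (_ : (fun _ => _) = (fun w : E * E =>
     \sum_(ab : {ffun 'I_d -> 'I_m.+1} * {ffun 'I_d -> 'I_m.+1} |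
        (mdeg (mi ab.1) + mdeg (mi ab.2) == m)%N)
      complex.Re (c (mi ab.1) (mi ab.2)) * monomial (mi ab.2) w.1 * monomial (mi ab.1) w.2)).
    by apply: sum_continuous => ab; exact: monomial2_continuous.
  apply/funext => w; rewrite /psymbol; elim/big_ind2: _ => //= [p q p' q' <- <-|ab _].
    by rewrite Re_addc.
  by rewrite !Re_mulc /= !mulr0 !subr0.
rewrite (_ : (fun _ => _) = (fun w : E * E =>
   \sum_(ab : {ffun 'I_d -> 'I_m.+1} * {ffun 'I_d -> 'I_m.+1} |
      (mdeg (mi ab.1) + mdeg (mi ab.2) == m)%N)
    complex.Im (c (mi ab.1) (mi ab.2)) * monomial (mi ab.2) w.1 * monomial (mi ab.1) w.2)).
  by apply: sum_continuous => ab; exact: monomial2_continuous.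
apply/funext => w; rewrite /psymbol; elim/big_ind2: _ => //= [p q p' q' <- <-|ab _].
  by rewrite Im_addc.
by rewrite !Im_mulc !Re_mulc /= !mulr0 !add0r.
Qed.

(** The real or the imaginary part is non-zero at [p]; it keeps half its size nearby and is
    dominated by the modulus. *)
Lemma psymbol_away_from0 m (c : ('I_d -> nat) -> ('I_d -> nat) -> C) (p : E * E) :
  psymbol m c p.1 p.2 <> 0 ->
  exists2 c0 : R, 0 < c0 & \forall w \near p, c0 <= normc (psymbol m c w.1 w.2).
Proof.
move=> ps0; have [cr ci] := psymbol_continuous m c.
have aux (f : E * E -> R) : continuous f -> f p != 0 ->
    \forall w \near p, `|f p| / 2 <= `|f w|.
  move=> cf fp; have f0 : 0 < `|f p| / 2 by rewrite divr_gt0 ?normr_gt0.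
  have /cvgrPdist_lt/(_ _ f0) := cf p; apply: filterS => w hw.
  have := ler_distD (f w) (f p) 0; rewrite !subr0; lra.
have [r0|r0] := eqVneq (complex.Re (psymbol m c p.1 p.2)) 0.
  have i0 : complex.Im (psymbol m c p.1 p.2) != 0.
    apply/eqP => i0; apply: ps0; move: r0 i0; case: (psymbol _ _ _ _) => u v /= -> -> //.
  exists (`|complex.Im (psymbol m c p.1 p.2)| / 2); first by rewrite divr_gt0 ?normr_gt0.
  apply: filterS (aux _ ci i0) => w; move/le_trans; apply; exact: ler_Im_normc.
exists (`|complex.Re (psymbol m c p.1 p.2)| / 2); first by rewrite divr_gt0 ?normr_gt0.
apply: filterS (aux _ cr r0) => w; move/le_trans; apply; exact: ler_Re_normc.
Qed.

Lemma ler_enorm x i : `|x 0 i| <= enorm x.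
Proof.
rewrite /enorm -sqrtr_sqr ler_wsqrtr// /dot (bigD1 i)//= expr2 lerDl.
by apply: sumr_ge0 => j _; rewrite -expr2 sqr_ge0.
Qed.

Lemma enorm_le x (r : R) : 0 <= r -> (forall i, `|x 0 i| <= r) -> enorm x <= d%:R * r.
Proof.
move=> r0 hx; rewrite -[leRHS]ger0_norm ?mulr_ge0// -sqrtr_sqr ler_wsqrtr// /dot.
apply: (@le_trans _ _ (d%:R * r ^+ 2)).
  rewrite mulr_natl -[d in leRHS]card_ord -sumr_const; apply: ler_sum => i _.
  by rewrite -expr2 -real_normK ?num_real// lerXn2r ?nnegrE.
rewrite exprMn; apply: ler_wpM2r; first exact: sqr_ge0.
by rewrite expr2 -natrM ler_nat; case: (d) => // n; rewrite leq_pmulr.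
Qed.

End PrincipalSymbol.

Theorem theorem4p6 (R : realType) (d m : nat) (theta : R)
    (htheta : 2^-1 <= theta < 1)
    (c : ('I_d -> nat) -> ('I_d -> nat) -> R[i])
    (u : ('rV[R]_d -> R[i]) -> R[i]) (hu : GS_dual theta u) :
  WFgl theta u `<=` WFgl theta (diffop m c u) `|` Char m c.
Proof.
move=> [x0 xi0] [pn0 hwf].
have [ps0|ps0] := pselect (psymbol m c x0 xi0 = 0); [by right|left].
split => // -[G [oG [_ cG] Gp] [A [eps [A0 eps0 hG]]]]; apply: hwf.
have /andP[th _] := htheta.
have theta_gt0 : 0 < theta by apply: lt_le_trans th; rewrite invr_gt0.
set p := theta^-1 in hG *; have p0 : 0 < p by rewrite invr_gt0.
(* A coordinate bounded away from 0 gives the lower bound on |x| or |xi| over the slices. *)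
have [a0 a00 [i hi]] : exists2 a0 : R, 0 < a0 & exists i, a0 <= `|x0 0 i| \/ a0 <= `|xi0 0 i|.
  apply: contrapT => h; apply: pn0.
  have z0 (y : 'rV[R]_d) : (forall i, `|y 0 i| <= `|x0 0 i| \/ `|y 0 i| <= `|xi0 0 i|) -> y = 0.
    move=> hy; apply/rowP => i; rewrite mxE; apply/eqP; rewrite -normr_eq0; apply/eqP.
    apply: contrapT => /eqP y0; apply: h; exists `|y 0 i|; first by rewrite lt_def y0 normr_ge0.
    by exists i; exact: hy.
  by congr pair; apply: z0 => i; [left|right].
have [c0 c00 hc0] := psymbol_away_from0 (p := (x0, xi0)) ps0.
have /nbhs_ballP[e e0 he] : nbhs (x0, xi0) ([set w | c0 <= normc (psymbol m c w.1 w.2)] `&` G).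
  by apply: filterI => //; exact: open_nbhs_nbhs.
(* [e] keeps the rescaled slices where the symbol is elliptic and [G] holds; [a0 / 2] keeps the
   chosen coordinate at least a0/2 times lam in modulus. *)
pose kappa := Num.min e (a0 / 2).
have kappa0 : 0 < kappa by rewrite lt_min e0 divr_gt0.
have ka : kappa <= a0 / 2 by rewrite ge_min lexx orbT.
have ke : kappa <= e by rewrite ge_min lexx.
pose b := 1 + \sum_i `|x0 0 i| + \sum_i `|xi0 0 i| + kappa.
have sx0 : 0 <= \sum_i `|x0 0 i| by exact: sumr_ge0.
have sxi0 : 0 <= \sum_i `|xi0 0 i| by exact: sumr_ge0.
have b1 : 1 <= b by rewrite /b; lra.
have b0 : 0 < b by exact: lt_le_trans b1.
have sub lam (x xi : 'rV[R]_d) : 0 < lam -> cone_slice x0 xi0 lam (kappa * lam) x xi ->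
    ball (x0, xi0) e (lam^-1 *: x, lam^-1 *: xi).
  move=> l0 [hx hxi].
  have sc (y y0 : 'rV[R]_d) : (forall j, `|y 0 j - lam * y0 0 j| < kappa * lam) -> ball y0 e (lam^-1 *: y).
    move=> hy; split => // k j; rewrite (ord1 k) !mxE; apply: lt_le_trans ke.
    have -> : y0 0 j - lam^-1 * y 0 j = - (y 0 j - lam * y0 0 j) / lam by field; rewrite gt_eqF.
    by rewrite normf_div normrN (gtr0_norm l0) ltr_pdivrMr.
  by split; apply: sc.
have slice_bound lam (x xi : 'rV[R]_d) : 0 < lam -> cone_slice x0 xi0 lam (kappa * lam) x xi ->
    (forall i, `|x 0 i| <= b * lam) /\ (forall i, `|xi 0 i| <= b * lam).
  move=> l0 [hx hxi]; split=> j.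
    have xj : `|x0 0 j| <= \sum_i `|x0 0 i| by rewrite (bigD1 j)//= lerDl sumr_ge0.
    have := ler_distD (lam * x0 0 j) (x 0 j) 0; rewrite !subr0 normrM (gtr0_norm l0) => h.
    apply: le_trans h _; have := hx j; rewrite /b; nra.
  have xj : `|xi0 0 j| <= \sum_i `|xi0 0 i| by rewrite (bigD1 j)//= lerDl sumr_ge0.
  have := ler_distD (lam * xi0 0 j) (xi 0 j) 0; rewrite !subr0 normrM (gtr0_norm l0) => h.
  apply: le_trans h _; have := hxi j; rewrite /b; nra.
have lamK lam (x : 'rV[R]_d) : 0 < lam -> lam *: (lam^-1 *: x) = x.
  by move=> l0; rewrite scalerA mulfV ?scale1r// gt_eqF.
(* On a slice |x| or |xi| is at least (a0/2) lam, which turns decay in (x, xi) into decay in lam. *)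
pose e1 := eps * (a0 / 2) `^ p.
have e10 : 0 < e1 by rewrite mulr_gt0// powR_gt0// divr_gt0.
have slice_decay lam (x xi : 'rV[R]_d) : 0 < lam -> cone_slice x0 xi0 lam (kappa * lam) x xi ->
    normc (diffop m c u (wave_packet x xi)) <= A * expR (- (e1 * lam `^ theta^-1)).
  move=> l0 hs; have [_ /(cG lam _ l0) /=] := he _ (sub _ _ _ l0 hs).
  rewrite !lamK// => /hG h; apply: le_trans h _; apply: ler_wpM2l; first exact: ltW.
  rewrite ler_expR lerN2 -/p /e1 -mulrA -powRM ?divr_ge0 ?(ltW l0) ?(ltW a00)//.
  apply: ler_wpM2l; first exact: ltW.
  have half (y y0 : 'rV[R]_d) : (forall j, `|y 0 j - lam * y0 0 j| < kappa * lam) ->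
      a0 <= `|y0 0 i| -> (a0 / 2 * lam) `^ p <= enorm y `^ p.
    move=> hy hy0; apply: ge0_ler_powR; rewrite ?nnegrE ?sqrtr_ge0 ?mulr_ge0 ?divr_ge0 ?(ltW l0) ?(ltW a00) ?(ltW p0)//.
    apply: le_trans (ler_enorm y i); have := ler_distD (y 0 i) (lam * y0 0 i) 0.
    rewrite !subr0 normrM (gtr0_norm l0) distrC => h; have := hy i; nra.
  have [hx hxi] := hs; case: hi => hi.
    by apply: le_trans (half _ _ hx hi) _; rewrite lerDl powR_ge0.
  by apply: le_trans (half _ _ hxi hi) _; rewrite lerDr powR_ge0.
have slice_elliptic lam (x xi : 'rV[R]_d) : 0 < lam -> cone_slice x0 xi0 lam (kappa * lam) x xi ->
    c0 * lam ^+ m <= normc (psymbol m c x xi).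
  move=> l0 hs; have [/= h _] := he _ (sub _ _ _ l0 hs).
  rewrite -(lamK lam x l0) -(lamK lam xi l0) psymbolZ normcM normc_real mulrC.
  by rewrite ger0_norm ?exprn_ge0 ?(ltW l0)//; apply: ler_wpM2l; rewrite ?exprn_ge0 ?(ltW l0).
have [C0 [e2 [C00 e20 hF]]] := slice_wave_packet_decay th hu kappa0 c00 b1 A0 e10 slice_bound slice_decay slice_elliptic.
pose V := ball (x0, xi0) (kappa / 2).
have k20 : 0 < kappa / 2 by rewrite divr_gt0.
(* The cone over [V]; its points lie in the half slices where decay was obtained, with lam = 1/t. *)
exists [set w | exists2 t : R, 0 < t & V (t *: w)].
  split.
  - rewrite openE => w [t t0 Vw]; rewrite /interior.
    have : nbhs (t *: w) V by apply: open_nbhs_nbhs; split => //; exact: ball_open.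
    have ct : {for w, continuous (fun w : 'rV[R]_d * 'rV[R]_d => t *: w)} by exact: scaler_continuous.
    move=> hV; have : nbhs w ((fun w => t *: w) @^-1` V) by exact: ct hV.
    by move=> /nbhs_ballP[r r0 hr]; apply/nbhs_ballP; exists r => // z /hr Vz; exists t.
  - split.
    (* If 0 were in [V], the chosen coordinate would be below kappa/2 <= a0/4. *)
    + move=> [t t0]; rewrite scaler0 => -[[_ h1] [_ h2]].
      case: hi => hi; [have := h1 0 i|have := h2 0 i];
      by rewrite /ball /= mxE subr0; move: hi ka; lra.
    + move=> s w s0 [t t0 Vw]; exists (t / s); first by rewrite divr_gt0.
      rewrite (_ : _ *: _ = t *: w)//; case: w Vw => w1 w2 Vw.
      by congr pair => /=; rewrite scalerA divfK// gt_eqF.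
  - by exists 1 => //; rewrite scale1r; exact: ballxx.
pose D := (d%:R * b) `^ p.
have D0 : 0 <= D by exact: powR_ge0.
(* On a slice |x|^p + |xi|^p <= 2 D lam^p, which turns decay in lam back into decay in (x, xi); the
   1 keeps the denominator positive. *)
exists C0, (e2 / (2 * D + 1)); split => //.
  by rewrite divr_gt0//; lra.
move=> x xi [t t0 [[_ h1] [_ h2]]].
have l0 : 0 < t^-1 by rewrite invr_gt0.
have sc (y y0 : 'rV[R]_d) : (forall k j, ball (y0 k j) (kappa / 2) ((t *: y) k j)) ->
    forall j, `|y 0 j - t^-1 * y0 0 j| < kappa * t^-1 / 2.
  move=> hy j; have := hy 0 j; rewrite /ball /= mxE distrC => h.
  have -> : y 0 j - t^-1 * y0 0 j = t^-1 * (t * y 0 j - y0 0 j) by field; rewrite gt_eqF.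
  rewrite normrM (gtr0_norm l0) mulrAC [ltRHS]mulrC.
  by rewrite ltr_pM2l.
have hs : cone_slice x0 xi0 t^-1 (kappa * t^-1 / 2) x xi.
  by split; [exact: sc h1|exact: sc h2].
apply: le_trans (hF _ _ _ l0 hs) _; apply: ler_wpM2l; first exact: ltW.
rewrite ler_expR lerN2 -/p.
have [bx bxi] : (forall i, `|x 0 i| <= b * t^-1) /\ (forall i, `|xi 0 i| <= b * t^-1).
  apply: slice_bound => //; have kt : 0 < kappa * t^-1 by exact: mulr_gt0.
  by have [g1 g2] := hs; split=> j; [move: (g1 j)|move: (g2 j)]; lra.
have up (y : 'rV[R]_d) : (forall i, `|y 0 i| <= b * t^-1) -> enorm y `^ p <= D * t^-1 `^ p.
  move=> hy; rewrite /D -powRM ?mulr_ge0 ?(ltW b0) ?(ltW l0)//.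
  apply: ge0_ler_powR; rewrite ?nnegrE ?sqrtr_ge0 ?mulr_ge0 ?(ltW b0) ?(ltW l0) ?(ltW p0)//.
  by rewrite -mulrA; apply: enorm_le => //; rewrite mulr_ge0 ?(ltW b0) ?(ltW l0).
rewrite -mulrA; apply: ler_wpM2l; first exact: ltW.
have D1 : 0 < 2 * D + 1 by lra.
rewrite mulrC ler_pdivrMr//; have := up _ bx; have := up _ bxi; have := powR_ge0 t^-1 p; lra.
Qed.
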